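(* Let $m\geq 2$ be an integer, $\mathbf{p}=(p_1,\ldots,p_m)\in[2,+\infty]^m$ with $\left|\frac{1}{\mathbf{p}}\right|\leq\frac12$, and $\mathbf{r}=(r_1,\ldots,r_m)\in(0,+\infty)^m$. Let $\rho_{HL}:=\frac{2m}{m+1-2\left|\frac{1}{\mathbf{p}}\right|}$, $M_<^{HL}:=\{j\in\{1,\ldots,m\}: r_j<\rho_{HL}\}$ and $$s:=\sum_{j\in M_<^{HL}}\frac{1}{r_j}-\frac{m+1-2\left|\frac{1}{\mathbf{p}}\right|}{2m}\,|M_<^{HL}|.$$ Then there exists a constant $D^{\mathbb{K}}_{m,\mathbf{p}}\geq 1$ such that for every positive integer $n$ and every $m$-linear form $T:\ell_{p_1}^n\times\cdots\times\ell_{p_m}^n\to\mathbb{K}$, $$\left(\sum_{i_1=1}^n\left(\cdots\left(\sum_{i_m=1}^n|T(e_{i_1},\ldots,e_{i_m})|^{r_m}\right)^{\frac{r_{m-1}}{r_m}}\cdots\right)^{\frac{r_1}{r_2}}\right)^{\frac{1}{r_1}}\leq D^{\mathbb{K}}_{m,\mathbf{p}}\, n^{s}\,\|T\|.$$ Moreover, when $M_<^{HL}=\{1,\ldots,m\}$ or $M_<^{HL}=\emptyset$ the exponent $s$ is optimal, i.e. the inequality fails (for suitable $n$ and $T$) if $n^s$ is replaced by $n^t$ with $t<s$, whatever the constant.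
   Context: $\mathbb{K}=\mathbb{R}$ or $\mathbb{C}$. For a positive integer $n$ and $p\in[1,\infty]$, $\ell_p^n$ is $\mathbb{K}^n$ with the $\ell_p$-norm (sup norm if $p=\infty$); $e_j$ denotes the $j$-th canonical unit vector. For $\mathbf{p}=(p_1,\ldots,p_m)\in[1,\infty]^m$, $\left|\frac{1}{\mathbf{p}}\right|:=\frac{1}{p_1}+\cdots+\frac{1}{p_m}$. $\|T\|$ is the usual norm $\sup\{|T(x^{(1)},\ldots,x^{(m)})|:\|x^{(j)}\|_{p_j}\le 1\}$. $|M|$ denotes the cardinality of a set $M$. *)

(* Defs.v *)
From Stdlib Require Import Reals Lra Lia.
Open Scope R_scope.

Inductive field_kind := KR | KC.

Definition scal (k : field_kind) : Type :=
  match k with KR => R | KC => (R * R)%type end.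

Definition Cadd (a b : R * R) : R * R := (fst a + fst b, snd a + snd b).
Definition Cmul (a b : R * R) : R * R :=
  (fst a * fst b - snd a * snd b, fst a * snd b + snd a * fst b).
Definition Cmod (a : R * R) : R := sqrt (fst a * fst a + snd a * snd a).

Definition sadd (k : field_kind) : scal k -> scal k -> scal k :=
  match k return scal k -> scal k -> scal k with KR => Rplus | KC => Cadd end.
Definition smul (k : field_kind) : scal k -> scal k -> scal k :=
  match k return scal k -> scal k -> scal k with KR => Rmult | KC => Cmul end.
Definition sabs (k : field_kind) : scal k -> R :=
  match k return scal k -> R with KR => Rabs | KC => Cmod end.
Definition szero (k : field_kind) : scal k :=
  match k return scal k with KR => 0 | KC => (0, 0) end.
Definition sone (k : field_kind) : scal k :=
  match k return scal k with KR => 1 | KC => (1, 0) end.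

(** Real power x^y for x >= 0 and y > 0, with the convention 0^y = 0. *)
Definition rpow (x y : R) : R := if Rle_dec x 0 then 0 else Rpower x y.

Fixpoint rsum (n : nat) (f : nat -> R) : R :=
  match n with O => 0 | S n' => rsum n' f + f n' end.

Inductive ExtR := Fin (q : R) | Inf.
Definition invp (p : ExtR) : R := match p with Fin q => 1 / q | Inf => 0 end.
Definition ge2 (p : ExtR) : Prop := match p with Fin q => 2 <= q | Inf => True end.

(** Vectors of K^n are functions nat -> K (coordinates 0..n-1 used). *)
Fixpoint supnorm (k : field_kind) (n : nat) (x : nat -> scal k) : R :=
  match n with O => 0 | S n' => Rmax (supnorm k n' x) (sabs k (x n')) end.

Definition lpnorm (k : field_kind) (n : nat) (p : ExtR) (x : nat -> scal k) : R :=
  match p with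
  | Fin q => rpow (rsum n (fun i => rpow (sabs k (x i)) q)) (1 / q)
  | Inf => supnorm k n x
  end.

Definition ebasis (k : field_kind) (i : nat) : nat -> scal k :=
  fun l => if Nat.eqb l i then sone k else szero k.

(** A tuple of m vectors: X j is the j-th vector (j = 0..m-1). *)
Definition updv {A : Type} (X : nat -> A) (j : nat) (u : A) : nat -> A :=
  fun j' => if Nat.eqb j' j then u else X j'.

Definition multilinear (k : field_kind) (m n : nat)
  (T : (nat -> nat -> scal k) -> scal k) : Prop :=
  (forall X Y : nat -> nat -> scal k,
      (forall j l, (j < m)%nat -> (l < n)%nat -> X j l = Y j l) -> T X = T Y) /\
  (forall (j : nat) (X : nat -> nat -> scal k) (u v : nat -> scal k) (c : scal k),
      (j < m)%nat ->
      T (updv X j (fun l => sadd k (u l) (smul k c (v l))))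
      = sadd k (T (updv X j u)) (smul k c (T (updv X j v)))).

Definition is_opnorm (k : field_kind) (m n : nat) (p : nat -> ExtR)
  (T : (nat -> nat -> scal k) -> scal k) (N : R) : Prop :=
  is_lub (fun y => exists X : nat -> nat -> scal k,
             (forall j, (j < m)%nat -> lpnorm k n (p j) (X j) <= 1) /\
             y = sabs k (T X)) N.

(** Iterated mixed norm: slots k, k+1, ..., k+d-1 are summed with exponents
    r k, ..., r (k+d-1) (innermost = last slot); idx records fixed indices. *)
Fixpoint mixn (n : nat) (r : nat -> R) (k d : nat) (F : (nat -> nat) -> R)
  (idx : nat -> nat) : R :=
  match d with
  | O => F idx
  | S d' => rpow (rsum n (fun i => rpow (mixn n r (S k) d' F (updv idx k i)) (r k)))
                 (1 / r k)
  end.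

(** ( sum_{i1} ( ... ( sum_{im} |T(e_i1,...,e_im)|^{r_m} )^{r_{m-1}/r_m} ... )^{r_1/r_2} )^{1/r_1}
    with 0-based slots: r 0 = r_1, ..., r (m-1) = r_m. *)
Definition mixed_sum (k : field_kind) (m n : nat) (r : nat -> R)
  (T : (nat -> nat -> scal k) -> scal k) : R :=
  mixn n r 0 m (fun idx => sabs k (T (fun j => ebasis k (idx j)))) (fun _ => O).

Definition invp_sum (m : nat) (p : nat -> ExtR) : R := rsum m (fun j => invp (p j)).

Definition rhoHL (m : nat) (p : nat -> ExtR) : R :=
  2 * INR m / (INR m + 1 - 2 * invp_sum m p).

Definition cardM (m : nat) (p : nat -> ExtR) (r : nat -> R) : R :=
  rsum m (fun j => if Rlt_dec (r j) (rhoHL m p) then 1 else 0).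

Definition s_exp (m : nat) (p : nat -> ExtR) (r : nat -> R) : R :=
  rsum m (fun j => if Rlt_dec (r j) (rhoHL m p) then 1 / r j else 0)
  - (INR m + 1 - 2 * invp_sum m p) / (2 * INR m) * cardM m p r.

(* Main.v *)
Require Import Defs.
From Stdlib Require Import Reals Lra Lia Psatz FunctionalExtensionality.
Open Scope R_scope.

(** Upper bound.  Multiplying the slots of T by vectors x^(l) of the unit balls
    of l_{p_l} gives forms on l_oo, for which Khinchine's inequality, used in all
    slots but the j-th, yields an l_1(l_2) bound on the coefficients
    T(e_i) prod_l x^(l)_{i_l}.  The weights x^(l) are then removed one slot at a
    time, each removal lowering 1/lambda by 1/p_l, so that the coefficients lie
    in l_lambda(l_2) for every j, with 1/lambda = 1 - |1/p|.  Writing R_j for the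
    marginals of |T(e_i)|^2, a pointwise weighted AM-GM inequality
    between |T(e_i)|^2 prod_j R_j^(-delta) and prod_j R_j^(lambda/2) turns these m
    bounds into the l_rho bound, rho = rho_HL.  Each inner norm of exponent
    r_j is compared with the l_rho norm, at the cost n^(1/r_j - 1/rho) when r_j < rho.

    Sharpness.  If all r_j < rho, take a form with random signs as coefficients:
    exponential moments and a net show that its norm is at most
    n^(1/2 + m/2 - |1/p|), up to an arbitrarily small power of n.  If no r_j < rho,
    take the product of the first coordinates. *)

(** Everything is phrased through the squared coefficients [F] and their marginals: an l_lambda(l_2)
    bound with 1/lambda = a says that the powers 1/(2a) of the marginals sum to at most 1. Dividing
    T by (9/2)^m N beforehand keeps all these bounds equal to 1, so no constant travels through the
    interpolations and the final one depends on neither the p_j nor the r_j. Removing the weight of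
    slot k is plain duality for the marginals of slot k itself; the marginals of the other slots
    must be interpolated against a bound inherited from slot k, which is why each removal treats all
    slots at once. The hypothesis on |1/p| keeps lambda at most 2 throughout, as that interpolation
    demands. Complex scalars need no complex Khinchine inequality: canonical vectors are real, so
    the real and imaginary parts of T on real vectors suffice. For sharpness, the loss n^de pays for
    the logarithm of the mesh of the net; it is harmless because t < s leaves room. *)

(** * Finite real sums *)

Lemma rsum_ext n f g : (forall i, (i < n)%nat -> f i = g i) -> rsum n f = rsum n g.
Proof. induction n; intros H; simpl; auto. rewrite IHn, H; auto. Qed.

Lemma rsum_le n f g : (forall i, (i < n)%nat -> f i <= g i) -> rsum n f <= rsum n g.
Proof.
  induction n; intros H; simpl; [lra|].
  assert (f n <= g n) by auto. assert (rsum n f <= rsum n g) by auto. lra.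
Qed.

Lemma rsum_nonneg n f : (forall i, (i < n)%nat -> 0 <= f i) -> 0 <= rsum n f.
Proof.
  induction n; intros H; simpl; [lra|].
  assert (0 <= f n) by auto. assert (0 <= rsum n f) by auto. lra.
Qed.

Lemma rsum_plus n f g : rsum n (fun i => f i + g i) = rsum n f + rsum n g.
Proof. induction n; simpl; [lra|]. rewrite IHn; lra. Qed.

Lemma rsum_scal n c f : rsum n (fun i => c * f i) = c * rsum n f.
Proof. induction n; simpl; [lra|]. rewrite IHn; lra. Qed.

Lemma rsum_const n c : rsum n (fun _ => c) = INR n * c.
Proof. induction n; [simpl; lra|]. rewrite S_INR. simpl. rewrite IHn; lra. Qed.

Lemma rsum_zero n : rsum n (fun _ => 0) = 0.
Proof. rewrite rsum_const; lra. Qed.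

Lemma rsum_swap n m (f : nat -> nat -> R) :
  rsum n (fun i => rsum m (f i)) = rsum m (fun j => rsum n (fun i => f i j)).
Proof.
  induction n; simpl; [symmetry; apply rsum_zero|].
  rewrite IHn, <- rsum_plus. reflexivity.
Qed.

Lemma rsum_term_le n f i :
  (forall i, (i < n)%nat -> 0 <= f i) -> (i < n)%nat -> f i <= rsum n f.
Proof.
  induction n; intros H Hi; simpl; [lia|].
  assert (0 <= rsum n f) by (apply rsum_nonneg; auto).
  assert (0 <= f n) by auto.
  destruct (Nat.eq_dec i n) as [->|]; [lra|].
  assert (f i <= rsum n f) by (apply IHn; auto; lia). lra.
Qed.

Lemma rsum_pick n j f :
  (j < n)%nat -> rsum n (fun i => if Nat.eqb i j then f i else 0) = f j.
Proof.
  induction n; intros H; [lia|]. simpl.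
  destruct (Nat.eqb_spec n j) as [->|Hn].
  - rewrite (rsum_ext j _ (fun _ => 0)).
    + rewrite rsum_zero; lra.
    + intros i Hi. destruct (Nat.eqb_spec i j); [lia|reflexivity].
  - rewrite IHn by lia. lra.
Qed.

Lemma rsum_Rabs n f : Rabs (rsum n f) <= rsum n (fun i => Rabs (f i)).
Proof.
  induction n; simpl; [rewrite Rabs_R0; lra|].
  eapply Rle_trans; [apply Rabs_triang|]. lra.
Qed.

(** * Real powers, extended by 0 to nonpositive bases *)

Lemma rpow_pos x y : 0 < x -> rpow x y = Rpower x y.
Proof. intros H. unfold rpow. destruct (Rle_dec x 0); [lra|reflexivity]. Qed.

Lemma rpow_zero x y : x <= 0 -> rpow x y = 0.
Proof. intros H. unfold rpow. destruct (Rle_dec x 0); [reflexivity|lra]. Qed.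

Lemma rpow_gt0 x y : 0 < x -> 0 < rpow x y.
Proof. intros H. rewrite rpow_pos by auto. apply exp_pos. Qed.

Lemma rpow_ge0 x y : 0 <= rpow x y.
Proof.
  destruct (Rle_dec x 0).
  - rewrite rpow_zero; lra.
  - left; apply rpow_gt0; lra.
Qed.

Lemma rpow_plus x a b : rpow x (a + b) = rpow x a * rpow x b.
Proof.
  destruct (Rle_dec x 0).
  - rewrite !rpow_zero by auto; lra.
  - rewrite !rpow_pos by lra. apply Rpower_plus.
Qed.

Lemma rpow_rpow x a b : rpow (rpow x a) b = rpow x (a * b).
Proof.
  destruct (Rle_dec x 0).
  - rewrite (rpow_zero x a), (rpow_zero x) by auto. apply rpow_zero; lra.
  - rewrite (rpow_pos (rpow x a)) by (apply rpow_gt0; lra).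
    rewrite !(rpow_pos x) by lra. apply Rpower_mult.
Qed.

Lemma rpow_mult x y a : 0 <= x -> 0 <= y -> rpow (x * y) a = rpow x a * rpow y a.
Proof.
  intros Hx Hy.
  destruct (Req_dec x 0) as [->|]; [rewrite !(rpow_zero 0), rpow_zero by lra; lra|].
  destruct (Req_dec y 0) as [->|]; [rewrite !(rpow_zero 0), rpow_zero by lra; lra|].
  rewrite !rpow_pos by nra. symmetry; apply Rpower_mult_distr; lra.
Qed.

Lemma rpow_1 x : 0 <= x -> rpow x 1 = x.
Proof.
  intros H. destruct (Req_dec x 0) as [->|]; [apply rpow_zero; lra|].
  rewrite rpow_pos by lra. apply Rpower_1; lra.
Qed.

Lemma rpow_one a : rpow 1 a = 1.
Proof. rewrite rpow_pos by lra. unfold Rpower. rewrite ln_1, Rmult_0_r. apply exp_0. Qed.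

Lemma rpow_0 x : 0 < x -> rpow x 0 = 1.
Proof. intros H. rewrite rpow_pos by lra. apply Rpower_O; lra. Qed.

Lemma rpow_le x y a : 0 <= a -> x <= y -> rpow x a <= rpow y a.
Proof.
  intros Ha Hxy. destruct (Rle_dec x 0).
  - rewrite (rpow_zero x) by auto. apply rpow_ge0.
  - rewrite !rpow_pos by lra. apply Rle_Rpower_l; lra.
Qed.

Lemma rpow_le_1 x a : 0 <= a -> x <= 1 -> rpow x a <= 1.
Proof. intros. rewrite <- (rpow_one a). apply rpow_le; auto. Qed.

Lemma rpow_half x : 0 <= x -> rpow x (/ 2) = sqrt x.
Proof.
  intros H. destruct (Req_dec x 0) as [->|].
  - rewrite sqrt_0. apply rpow_zero; lra.
  - rewrite rpow_pos by lra. apply Rpower_sqrt; lra.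
Qed.

Lemma rpow_inv_cancel x a : 0 <= x -> a <> 0 -> rpow (rpow x a) (1 / a) = x.
Proof.
  intros. rewrite rpow_rpow. replace (a * (1 / a)) with 1 by (field; auto). apply rpow_1; auto.
Qed.

Lemma rpow_inv_cancel' x a : 0 <= x -> a <> 0 -> rpow (rpow x (1 / a)) a = x.
Proof.
  intros. rewrite rpow_rpow. replace (1 / a * a) with 1 by (field; auto). apply rpow_1; auto.
Qed.

(** * Convexity inequalities: Young, Hölder, arithmetic-geometric mean *)

(** The exponential lies above its tangent at ln v, evaluated at ln u. Taking for v a geometric mean
    makes the logarithmic terms cancel after averaging; this is the source of both [young] and
    [amgm]. *)
Lemma tangent_le u v : 0 < u -> 0 < v -> v * (1 + (ln u - ln v)) <= u.
Proof.
  intros Hu Hv.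
  assert (H : 1 + (ln u - ln v) <= u / v).
  { replace (u / v) with (exp (ln u - ln v)).
    - apply exp_ineq1_le.
    - unfold Rminus. rewrite exp_plus, exp_Ropp, !exp_ln by auto. reflexivity. }
  apply (Rmult_le_compat_l v) in H; [|lra].
  replace (v * (u / v)) with u in H by (field; lra). exact H.
Qed.

Lemma young x y th : 0 <= x -> 0 <= y -> 0 <= th <= 1 ->
  rpow x th * rpow y (1 - th) <= th * x + (1 - th) * y.
Proof.
  intros Hx Hy Ht.
  assert (0 <= th * x + (1 - th) * y) by nra.
  destruct (Req_dec x 0) as [->|]; [rewrite (rpow_zero 0) by lra; lra|].
  destruct (Req_dec y 0) as [->|]; [rewrite (rpow_zero 0) by lra; lra|].
  set (v := rpow x th * rpow y (1 - th)).
  assert (Hv : 0 < v) by (apply Rmult_lt_0_compat; apply rpow_gt0; lra).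
  assert (Hl : ln v = th * ln x + (1 - th) * ln y).
  { unfold v. rewrite !rpow_pos by lra. unfold Rpower.
    rewrite ln_mult by apply exp_pos. rewrite !ln_exp. reflexivity. }
  assert (T1 := tangent_le x v ltac:(lra) Hv).
  assert (T2 := tangent_le y v ltac:(lra) Hv).
  assert (E : v = th * (v * (1 + (ln x - ln v))) + (1 - th) * (v * (1 + (ln y - ln v)))).
  { rewrite Hl. ring. }
  rewrite E. apply Rplus_le_compat; apply Rmult_le_compat_l; lra.
Qed.

(** Normalise both sums to 1 and add up [young]. A vanishing sum is treated apart; there both sides
    are 0 by the convention for [rpow] at 0, even when th is 0 or 1. *)
Lemma rsum_holder n u v th : 0 <= th <= 1 ->
  (forall i, (i < n)%nat -> 0 <= u i) -> (forall i, (i < n)%nat -> 0 <= v i) ->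
  rsum n (fun i => rpow (u i) th * rpow (v i) (1 - th))
  <= rpow (rsum n u) th * rpow (rsum n v) (1 - th).
Proof.
  intros Ht Hu Hv.
  assert (Su := rsum_nonneg n u Hu). assert (Sv := rsum_nonneg n v Hv).
  destruct (Req_dec (rsum n u) 0) as [E|].
  { rewrite E, (rpow_zero 0 th), Rmult_0_l by lra.
    rewrite (rsum_ext n _ (fun _ => 0)); [rewrite rsum_zero; lra|].
    intros i Hi. assert (u i <= rsum n u) by (apply rsum_term_le; auto).
    rewrite (rpow_zero (u i)) by lra. lra. }
  destruct (Req_dec (rsum n v) 0) as [E|].
  { rewrite E, (rpow_zero 0 (1 - th)), Rmult_0_r by lra.
    rewrite (rsum_ext n _ (fun _ => 0)); [rewrite rsum_zero; lra|].
    intros i Hi. assert (v i <= rsum n v) by (apply rsum_term_le; auto).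
    rewrite (rpow_zero (v i)) by lra. lra. }
  set (U := rsum n u) in *. set (V := rsum n v) in *.
  set (K := rpow U th * rpow V (1 - th)).
  assert (HK : 0 < K) by (apply Rmult_lt_0_compat; apply rpow_gt0; lra).
  assert (H1 : rsum n (fun i => rpow (u i) th * rpow (v i) (1 - th))
    <= rsum n (fun i => (K * th / U) * u i + (K * (1 - th) / V) * v i)).
  { apply rsum_le. intros i Hi.
    assert (Y := young (u i / U) (v i / V) th).
    assert (EU : rpow (u i) th = rpow U th * rpow (u i / U) th).
    { rewrite <- rpow_mult; [f_equal; field; auto|lra|].
      apply Rle_mult_inv_pos; auto; lra. }
    assert (EV : rpow (v i) (1 - th) = rpow V (1 - th) * rpow (v i / V) (1 - th)).
    { rewrite <- rpow_mult; [f_equal; field; auto|lra|].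
      apply Rle_mult_inv_pos; auto; lra. }
    rewrite EU, EV.
    replace (rpow U th * rpow (u i / U) th * (rpow V (1 - th) * rpow (v i / V) (1 - th)))
      with (K * (rpow (u i / U) th * rpow (v i / V) (1 - th))) by (unfold K; ring).
    replace (K * th / U * u i + K * (1 - th) / V * v i)
      with (K * (th * (u i / U) + (1 - th) * (v i / V))) by (field; auto).
    apply Rmult_le_compat_l; [lra|]. apply Y; auto; apply Rle_mult_inv_pos; auto; lra. }
  eapply Rle_trans; [exact H1|].
  rewrite rsum_plus, !rsum_scal. fold U V. right. field. auto.
Qed.

(** Given by a starting slot and a length, so that it unfolds from the left in step with [msum] and
    [mixn]. *)
Fixpoint rprodr (l d : nat) (h : nat -> R) : R :=
  match d with O => 1 | S d' => h l * rprodr (S l) d' h end.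

Lemma rprodr_ext d : forall l h h',
  (forall i, (l <= i < l + d)%nat -> h i = h' i) -> rprodr l d h = rprodr l d h'.
Proof.
  induction d; intros l h h' H; simpl; auto.
  rewrite (H l) by lia. f_equal. apply IHd. intros; apply H; lia.
Qed.

Lemma rprodr_nonneg d : forall l h,
  (forall i, (l <= i < l + d)%nat -> 0 <= h i) -> 0 <= rprodr l d h.
Proof.
  induction d; intros l h H; simpl; [lra|].
  apply Rmult_le_pos; [apply H; lia|]. apply IHd. intros; apply H; lia.
Qed.

Lemma rprodr_pos d : forall l h,
  (forall i, (l <= i < l + d)%nat -> 0 < h i) -> 0 < rprodr l d h.
Proof.
  induction d; intros l h H; simpl; [lra|].
  apply Rmult_lt_0_compat; [apply H; lia|]. apply IHd. intros; apply H; lia.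
Qed.

Lemma rprodr_le_1 d : forall l h,
  (forall i, (l <= i < l + d)%nat -> 0 <= h i <= 1) -> rprodr l d h <= 1.
Proof.
  induction d; intros l h H; simpl; [lra|].
  assert (0 <= h l <= 1) by (apply H; lia).
  assert (rprodr (S l) d h <= 1) by (apply IHd; intros; apply H; lia).
  assert (0 <= rprodr (S l) d h) by (apply rprodr_nonneg; intros; apply H; lia).
  nra.
Qed.

Lemma rprodr_mult d : forall l g h,
  rprodr l d (fun i => g i * h i) = rprodr l d g * rprodr l d h.
Proof. induction d; intros; simpl; [lra|]. rewrite IHd; ring. Qed.

Lemma rprodr_rpow d : forall l h a, (forall i, (l <= i < l + d)%nat -> 0 <= h i) ->
  rpow (rprodr l d h) a = rprodr l d (fun i => rpow (h i) a).
Proof.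
  induction d; intros l h a H; simpl; [apply rpow_one|].
  rewrite rpow_mult.
  - f_equal. apply IHd. intros; apply H; lia.
  - apply H; lia.
  - apply rprodr_nonneg. intros; apply H; lia.
Qed.

Fixpoint rsumr (l d : nat) (h : nat -> R) : R :=
  match d with O => 0 | S d' => h l + rsumr (S l) d' h end.

Lemma rsumr_last d : forall l h, rsumr l (S d) h = rsumr l d h + h (l + d)%nat.
Proof.
  induction d; intros l h.
  - simpl. rewrite Nat.add_0_r. lra.
  - change (h l + rsumr (S l) (S d) h = h l + rsumr (S l) d h + h (l + S d)%nat).
    rewrite IHd. replace (l + S d)%nat with (S l + d)%nat by lia. lra.
Qed.

Lemma rsumr_rsum d h : rsumr 0 d h = rsum d h.
Proof. induction d; [reflexivity|]. rewrite rsumr_last, IHd. reflexivity. Qed.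

Lemma ln_rprodr d : forall l h, (forall i, (l <= i < l + d)%nat -> 0 < h i) ->
  ln (rprodr l d h) = rsumr l d (fun i => ln (h i)).
Proof.
  induction d; intros l h H; simpl; [apply ln_1|].
  rewrite ln_mult.
  - f_equal. apply IHd. intros; apply H; lia.
  - apply H; lia.
  - apply rprodr_pos. intros; apply H; lia.
Qed.

Lemma rprodr_Rpower d : forall l x a,
  rprodr l d (fun i => Rpower x (a i)) = Rpower x (rsumr l d a).
Proof.
  induction d; intros; simpl.
  - unfold Rpower. rewrite Rmult_0_l, exp_0. reflexivity.
  - rewrite IHd, Rpower_plus. reflexivity.
Qed.

Lemma amgm m h : (0 < m)%nat -> (forall i, (i < m)%nat -> 0 < h i) ->
  rprodr 0 m (fun i => rpow (h i) (/ INR m)) <= / INR m * rsum m h.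
Proof.
  intros Hm H.
  assert (HM : 0 < INR m) by (apply lt_0_INR; auto).
  set (v := rprodr 0 m (fun i => rpow (h i) (/ INR m))).
  assert (Hv : 0 < v) by (apply rprodr_pos; intros; apply rpow_gt0, H; lia).
  assert (Hl : ln v = / INR m * rsum m (fun i => ln (h i))).
  { unfold v. rewrite ln_rprodr by (intros; apply rpow_gt0, H; lia).
    rewrite rsumr_rsum, <- rsum_scal. apply rsum_ext. intros i Hi.
    rewrite rpow_pos by auto. unfold Rpower. apply ln_exp. }
  assert (S1 : rsum m (fun i => v * (1 + (ln (h i) - ln v))) <= rsum m h).
  { apply rsum_le. intros. apply tangent_le; auto. }
  rewrite rsum_scal, rsum_plus, rsum_const in S1.
  assert (S2 : rsum m (fun i => ln (h i) - ln v) = 0).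
  { unfold Rminus. rewrite rsum_plus, rsum_const, Hl. field. lra. }
  rewrite S2 in S1.
  apply (Rmult_le_compat_l (/ INR m)) in S1; [|left; apply Rinv_0_lt_compat; auto].
  replace (/ INR m * (v * (INR m * 1 + 0))) with v in S1 by (field; lra).
  exact S1.
Qed.

(** * Updating one entry of a tuple *)

Lemma updv_same {A} (X : nat -> A) l u : updv X l u l = u.
Proof. unfold updv. rewrite Nat.eqb_refl. reflexivity. Qed.

Lemma updv_other {A} (X : nat -> A) l u i : i <> l -> updv X l u i = X i.
Proof. intros H. unfold updv. apply Nat.eqb_neq in H. rewrite H. reflexivity. Qed.

Lemma updv_id {A} (X : nat -> A) l : updv X l (X l) = X.
Proof.
  apply functional_extensionality. intros i. unfold updv.
  destruct (Nat.eqb_spec i l); congruence.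
Qed.

Lemma updv_comm {A} (X : nat -> A) l l' u v : l <> l' ->
  updv (updv X l u) l' v = updv (updv X l' v) l u.
Proof.
  intros H. apply functional_extensionality. intros i. unfold updv.
  destruct (Nat.eqb_spec i l), (Nat.eqb_spec i l'); congruence.
Qed.

(** * Sums over multi-indices and their marginals *)

Fixpoint msum (n l d : nat) (F : (nat -> nat) -> R) (idx : nat -> nat) : R :=
  match d with
  | O => F idx
  | S d' => rsum n (fun i => msum n (S l) d' F (updv idx l i))
  end.

(** The multi-indices [idx'] at which [msum n l d F idx] evaluates F; pointwise comparisons are
    required only there. *)
Definition in_box (n l d : nat) (idx idx' : nat -> nat) : Prop :=
  forall i, ((l <= i < l + d)%nat -> (idx' i < n)%nat) /\
            (~ (l <= i < l + d)%nat -> idx' i = idx i).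

Lemma in_box_step n l d idx i idx' : (i < n)%nat ->
  in_box n (S l) d (updv idx l i) idx' -> in_box n l (S d) idx idx' /\ idx' l = i.
Proof.
  intros Hi H.
  assert (E : idx' l = i).
  { destruct (H l) as [_ H2]. rewrite H2 by lia. apply updv_same. }
  split; auto. intros j. destruct (H j) as [H1 H2]. split; intros Hj.
  - destruct (Nat.eq_dec j l) as [->|]; [lia|]. apply H1; lia.
  - rewrite H2 by lia. apply updv_other; lia.
Qed.

Lemma in_box_inv n l d idx idx' : in_box n l (S d) idx idx' ->
  (idx' l < n)%nat /\ in_box n (S l) d (updv idx l (idx' l)) idx'.
Proof.
  intros H. split; [apply H; lia|].
  intros j. destruct (H j) as [H1 H2]. split; intros Hj; [apply H1; lia|].
  destruct (Nat.eq_dec j l) as [->|]; [symmetry; apply updv_same|].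
  rewrite updv_other by auto. apply H2; lia.
Qed.

Lemma in_box_refl n l idx : in_box n l 0 idx idx.
Proof. intros i. split; [lia|auto]. Qed.

Lemma msum_le n d : forall l F G idx,
  (forall idx', in_box n l d idx idx' -> F idx' <= G idx') ->
  msum n l d F idx <= msum n l d G idx.
Proof.
  induction d; intros l F G idx H; simpl; [apply H, in_box_refl|].
  apply rsum_le. intros i Hi. apply IHd. intros idx' Hb. apply H.
  eapply in_box_step; eauto.
Qed.

Lemma msum_ext n d l F G idx :
  (forall idx', in_box n l d idx idx' -> F idx' = G idx') ->
  msum n l d F idx = msum n l d G idx.
Proof. intros H. apply Rle_antisym; apply msum_le; intros; right; rewrite H; auto. Qed.

Lemma msum_scal n d : forall l c F idx,
  msum n l d (fun i => c * F i) idx = c * msum n l d F idx.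
Proof.
  induction d; intros; simpl; auto. rewrite <- rsum_scal. apply rsum_ext. intros; apply IHd.
Qed.

Lemma msum_plus n d : forall l F G idx,
  msum n l d (fun i => F i + G i) idx = msum n l d F idx + msum n l d G idx.
Proof.
  induction d; intros; simpl; auto. rewrite <- rsum_plus. apply rsum_ext. intros; apply IHd.
Qed.

Lemma msum_rsum_swap n d : forall l N (F : nat -> (nat -> nat) -> R) idx,
  msum n l d (fun i => rsum N (fun x => F x i)) idx = rsum N (fun x => msum n l d (F x) idx).
Proof.
  induction d; intros; simpl; auto. rewrite rsum_swap. apply rsum_ext. intros; apply IHd.
Qed.

Lemma msum_zero n d : forall l idx, msum n l d (fun _ => 0) idx = 0.
Proof.
  induction d; intros; simpl; auto.
  rewrite (rsum_ext n _ (fun _ => 0)); [apply rsum_zero|auto].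
Qed.

Lemma msum_nonneg n d l F idx :
  (forall idx', in_box n l d idx idx' -> 0 <= F idx') -> 0 <= msum n l d F idx.
Proof. intros H. rewrite <- (msum_zero n d l idx). apply msum_le; auto. Qed.

Lemma msum_term_le n d : forall l F idx idx', (forall i, 0 <= F i) ->
  in_box n l d idx idx' -> F idx' <= msum n l d F idx.
Proof.
  induction d; intros l F idx idx' HF Hb; simpl.
  - right. f_equal. apply functional_extensionality. intros i. apply Hb; lia.
  - apply in_box_inv in Hb. destruct Hb as [Hi Hb].
    eapply Rle_trans; [apply IHd; eauto|].
    apply (rsum_term_le n (fun i => msum n (S l) d F (updv idx l i))); auto.
    intros; apply msum_nonneg; auto.
Qed.

Lemma msum_base n d : forall l F idx idx2,
  (forall i, ~ (l <= i < l + d)%nat -> idx i = idx2 i) ->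
  msum n l d F idx = msum n l d F idx2.
Proof.
  induction d; intros l F idx idx2 H; simpl.
  - f_equal. apply functional_extensionality. intros; apply H; lia.
  - apply rsum_ext. intros i Hi. apply IHd. intros j Hj. unfold updv.
    destruct (Nat.eqb_spec j l); auto. apply H; lia.
Qed.

Lemma msum_holder n d : forall l u v th idx, 0 <= th <= 1 ->
  (forall i, 0 <= u i) -> (forall i, 0 <= v i) ->
  msum n l d (fun i => rpow (u i) th * rpow (v i) (1 - th)) idx
  <= rpow (msum n l d u idx) th * rpow (msum n l d v idx) (1 - th).
Proof.
  induction d; intros l u v th idx Ht Hu Hv; simpl; [lra|].
  eapply Rle_trans; [|apply rsum_holder; auto; intros; apply msum_nonneg; auto].
  apply rsum_le. intros. apply IHd; auto.
Qed.

Lemma msum_prod n d : forall l (g : nat -> nat -> R) idx,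
  msum n l d (fun idx => rprodr l d (fun i => g i (idx i))) idx
  = rprodr l d (fun i => rsum n (g i)).
Proof.
  induction d; intros; simpl; auto.
  rewrite (rsum_ext n _ (fun i => rprodr (S l) d (fun i => rsum n (g i)) * g l i)).
  - rewrite rsum_scal. apply Rmult_comm.
  - intros i Hi.
    rewrite (msum_ext _ _ _ _ (fun idx => g l i * rprodr (S l) d (fun j => g j (idx j)))).
    + rewrite msum_scal, IHd. apply Rmult_comm.
    + intros idx' Hb. apply in_box_step in Hb; auto. destruct Hb as [_ <-]. reflexivity.
Qed.

Definition zidx : nat -> nat := fun _ => O.
Notation tot n m F := (msum n 0 m F zidx).
(** An indicator inside the full sum, rather than a sum over the remaining slots, treats every slot
    j alike without reordering the summation. *)
Definition marg (n m j tau : nat) (F : (nat -> nat) -> R) : R :=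
  tot n m (fun idx => if Nat.eqb (idx j) tau then F idx else 0).

Lemma marg_nonneg n m j tau F : (forall i, 0 <= F i) -> 0 <= marg n m j tau F.
Proof. intros H. apply msum_nonneg. intros. destruct Nat.eqb; [auto|lra]. Qed.

Lemma rsum_marg n m j F g : (j < m)%nat ->
  rsum n (fun tau => g tau * marg n m j tau F) = tot n m (fun idx => g (idx j) * F idx).
Proof.
  intros Hj. unfold marg.
  rewrite (rsum_ext n _ (fun tau => msum n 0 m
    (fun idx => g tau * (if Nat.eqb (idx j) tau then F idx else 0)) zidx))
    by (intros; symmetry; apply msum_scal).
  rewrite <- msum_rsum_swap. apply msum_ext. intros idx Hb.
  rewrite (rsum_ext n _ (fun tau => if Nat.eqb tau (idx j) then g tau * F idx else 0)).
  - rewrite (rsum_pick n (idx j) (fun tau => g tau * F idx)); auto. apply Hb; lia.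
  - intros. rewrite Nat.eqb_sym. destruct Nat.eqb; ring.
Qed.

Lemma marg_term_le n m j F idx : (j < m)%nat -> (forall i, 0 <= F i) ->
  in_box n 0 m zidx idx -> F idx <= marg n m j (idx j) F.
Proof.
  intros Hj HF Hb.
  pose proof (msum_term_le n m 0 (fun i => if Nat.eqb (i j) (idx j) then F i else 0) zidx idx) as H.
  simpl in H. rewrite Nat.eqb_refl in H. apply H; auto.
  intros i. destruct Nat.eqb; [auto|lra].
Qed.

Lemma marg_weight_same n m k tau G v :
  marg n m k tau (fun idx => G idx * v (idx k)) = v tau * marg n m k tau G.
Proof.
  unfold marg. rewrite <- msum_scal. apply msum_ext. intros idx _.
  destruct (Nat.eqb_spec (idx k) tau) as [<-|]; ring.
Qed.

Lemma marg_ext n m j tau F G : (forall idx, in_box n 0 m zidx idx -> F idx = G idx) ->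
  marg n m j tau F = marg n m j tau G.
Proof. intros H. apply msum_ext. intros. rewrite H; auto. Qed.

(** * From sup norms to l_p norms, one slot at a time *)

(* The same-slot case: optimise over the weight v in the unit ball of l_{q/2}. *)
Lemma lift_exponent_same n (K : nat -> R) q a : 0 < q -> / 2 <= a - / q ->
  (forall i, 0 <= K i) ->
  (forall v, (forall i, 0 <= v i) -> rsum n (fun i => rpow (v i) (q / 2)) <= 1 ->
     rsum n (fun i => rpow (v i * K i) (/ (2 * a))) <= 1) ->
  rsum n (fun i => rpow (K i) (/ (2 * (a - / q)))) <= 1.
Proof.
  intros Hq Hb HK H.
  assert (Hq' : 0 < / q) by (apply Rinv_0_lt_compat; auto).
  set (b := a - / q) in *. assert (Ha : a = b + / q) by (unfold b; lra).
  set (c := / (2 * b)).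
  set (S := rsum n (fun i => rpow (K i) c)).
  destruct (Rle_dec S 1) as [|HS]; auto. exfalso.
  assert (HS1 : 1 < S) by lra.
  (* The extremal weight of Hölder's inequality: v^(q/2) is proportional to K^c and normalised to
     have sum 1. *)
  specialize (H (fun i => rpow (rpow (K i) c / S) (2 / q))).
  assert (Hn : forall i, 0 <= rpow (K i) c / S).
  { intros. apply Rle_mult_inv_pos; [apply rpow_ge0|lra]. }
  assert (H1 : rsum n (fun i => rpow (rpow (rpow (K i) c / S) (2 / q)) (q / 2)) = 1).
  { rewrite (rsum_ext n _ (fun i => / S * rpow (K i) c)).
    - rewrite rsum_scal. fold S. field. lra.
    - intros. rewrite rpow_rpow. replace (2 / q * (q / 2)) with 1 by (field; lra).
      rewrite rpow_1 by auto. unfold Rdiv; ring. }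
  specialize (H (fun i => rpow_ge0 _ _) ltac:(lra)).
  rewrite (rsum_ext n _ (fun i => rpow (/ S) (2 / q * / (2 * a)) * rpow (K i) c)) in H.
  - rewrite rsum_scal in H. fold S in H.
    (* Since 1 - 1/(q a) = b/a, the hypothesis for this v bounds a positive power of S by 1, against
       S > 1. *)
    assert (E : rpow (/ S) (2 / q * / (2 * a)) * S = rpow S (b / a)).
    { rewrite !rpow_pos by (try apply Rinv_0_lt_compat; lra).
      rewrite <- (Rpower_1 S) at 2 by lra.
      unfold Rpower. rewrite ln_Rinv by lra. rewrite <- exp_plus. f_equal.
      rewrite Ha. field. repeat split; nra. }
    rewrite E in H.
    assert (1 < rpow S (b / a)).
    { rewrite rpow_pos by lra. rewrite <- (Rpower_O S) by lra.
      apply Rpower_lt; [lra|]. apply Rdiv_lt_0_compat; lra. }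
    lra.
  - intros i Hi. rewrite rpow_mult by (auto; apply rpow_ge0).
    rewrite rpow_rpow. unfold Rdiv at 1. rewrite rpow_mult.
    + rewrite rpow_rpow.
      replace (rpow (K i) c) with (rpow (K i) (c * (2 / q * / (2 * a)) + / (2 * a))).
      * rewrite rpow_plus. ring.
      * f_equal. unfold c. rewrite Ha. field. repeat split; try lra. nra.
    + apply rpow_ge0.
    + left. apply Rinv_0_lt_compat; lra.
Qed.

(** Slot k is settled by duality. For any slot j, Hölder's inequality bounds the marginal of G by
    U^th V^(1-th), where U carries the weight v and obeys the hypothesis with exponent a, while V
    carries a negative power of the k-marginals K and has total mass at most 1 by the bound for slot
    k. *)
Lemma lift_exponent n m k q a G : 0 < q -> / 2 <= a - / q -> (k < m)%nat ->
  (forall i, 0 <= G i) ->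
  (forall v, (forall i, 0 <= v i) -> rsum n (fun i => rpow (v i) (q / 2)) <= 1 ->
     forall j, (j < m)%nat ->
     rsum n (fun tau => rpow (marg n m j tau (fun idx => G idx * v (idx k))) (/ (2 * a))) <= 1) ->
  forall j, (j < m)%nat ->
  rsum n (fun tau => rpow (marg n m j tau G) (/ (2 * (a - / q)))) <= 1.
Proof.
  intros Hq Hb Hk HG H.
  assert (HKn : forall tau, 0 <= marg n m k tau G) by (intros; apply marg_nonneg; auto).
  assert (HK : rsum n (fun tau => rpow (marg n m k tau G) (/ (2 * (a - / q)))) <= 1).
  { apply (lift_exponent_same n (fun tau => marg n m k tau G) q a); auto.
    intros v Hv Hv1. erewrite rsum_ext; [apply (H v Hv Hv1 k Hk)|].
    intros i Hi. cbv beta. rewrite marg_weight_same. reflexivity. }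
  intros j Hj.
  assert (Hq' : 0 < / q) by (apply Rinv_0_lt_compat; auto).
  set (b := a - / q) in *. assert (Ha : a = b + / q) by (unfold b; lra).
  set (K := fun tau => marg n m k tau G) in *.
  (* Chosen so that v^(q/2) = K^(1/(2b)); the bound just proved for slot k then says exactly that v
     is admissible. *)
  set (v := fun i => rpow (K i) (/ b * / q)).
  assert (Hv : forall i, 0 <= v i) by (intros; apply rpow_ge0).
  specialize (H v Hv).
  assert (Hv1 : rsum n (fun i => rpow (v i) (q / 2)) <= 1).
  { eapply Rle_trans; [|exact HK]. right. apply rsum_ext. intros. unfold v.
    rewrite rpow_rpow. unfold K. f_equal. field. split; lra. }
  specialize (H Hv1 j Hj).
  (* The value for which the powers of K cancel: th/(b q) = be (1 - th). It lies in [0,1] because b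
     >= 1/2. *)
  set (th := (b - / 2) / (a - / 2)).
  assert (Hth : 0 <= th <= 1).
  { unfold th. split.
    - apply Rle_mult_inv_pos; lra.
    - apply (Rmult_le_reg_r (a - / 2)); [lra|].
      replace ((b - / 2) / (a - / 2) * (a - / 2)) with (b - / 2) by (field; lra). lra. }
  set (be := 1 - / (2 * b)).
  set (U := fun tau => marg n m j tau (fun idx => G idx * v (idx k))) in *.
  set (V := fun tau => marg n m j tau (fun idx => G idx * rpow (K (idx k)) (- be))).
  assert (HU0 : forall tau, 0 <= U tau)
    by (intros; apply marg_nonneg; intros; apply Rmult_le_pos; auto).
  assert (HV0 : forall tau, 0 <= V tau)
    by (intros; apply marg_nonneg; intros; apply Rmult_le_pos; auto; apply rpow_ge0).
  assert (HV : rsum n V <= 1).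
  { rewrite (rsum_ext n _ (fun tau => 1 * V tau)) by (intros; ring).
    unfold V. rewrite (rsum_marg n m j _ (fun _ => 1)) by auto.
    rewrite (msum_ext _ _ _ _ (fun idx => rpow (K (idx k)) (- be) * G idx)) by (intros; ring).
    (* The total mass is recomputed along slot k, where the weight turns K into K^(1-be) =
       K^(1/(2b)). *)
    rewrite <- (rsum_marg n m k G (fun i => rpow (K i) (- be))) by auto.
    eapply Rle_trans; [|exact HK]. right. apply rsum_ext. intros i Hi. fold (K i).
    rewrite <- (rpow_1 (K i)) at 2 by apply HKn. rewrite <- rpow_plus. f_equal. unfold be. lra. }
  assert (HR : forall tau, marg n m j tau G <= rpow (U tau) th * rpow (V tau) (1 - th)).
  { intros tau. unfold U, V, marg.
    eapply Rle_trans; [|apply msum_holder; auto].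
    - apply msum_le. intros idx Hbox. destruct Nat.eqb.
      2:{ rewrite (rpow_zero 0 th) by lra. lra. }
      destruct (Req_dec (G idx) 0) as [E|].
      { rewrite E, !Rmult_0_l, (rpow_zero 0) by lra. lra. }
      assert (0 <= G idx) by auto.
      (* Positivity matters: the powers of K combine to the exponent 0, and [rpow 0 0] is 0, not
         1. *)
      assert (HKp : 0 < K (idx k)).
      { assert (G idx <= K (idx k)) by (apply marg_term_le; auto). lra. }
      rewrite !rpow_mult by (auto; apply rpow_ge0).
      unfold v. rewrite !rpow_rpow. right.
      replace (rpow (G idx) th * rpow (K (idx k)) (/ b * / q * th) *
               (rpow (G idx) (1 - th) * rpow (K (idx k)) (- be * (1 - th))))
        with (rpow (G idx) (th + (1 - th)) * rpow (K (idx k)) (/ b * / q * th + - be * (1 - th)))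
        by (rewrite !rpow_plus; ring).
      replace (th + (1 - th)) with 1 by ring.
      replace (/ b * / q * th + - be * (1 - th)) with 0.
      + rewrite rpow_0, rpow_1 by auto. ring.
      + unfold be, th. replace (/ q) with (a - b) by lra. field. split; lra.
    - intros i. destruct Nat.eqb; [apply Rmult_le_pos; auto|lra].
    - intros i. destruct Nat.eqb; [apply Rmult_le_pos; auto; apply rpow_ge0|lra]. }
  (* Raising the Hölder bound to the power 1/(2b) gives (U^(1/(2a)))^A V^(1-A), so [young] separates
     two quantities whose sums are at most 1. *)
  set (A := th * a / b).
  assert (EA : 1 - A = (1 - th) * / (2 * b)).
  { unfold A, th. field. split; lra. }
  assert (HA : 0 <= A <= 1).
  { split.
    - unfold A. apply Rle_mult_inv_pos; [apply Rmult_le_pos; lra|lra].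
    - assert (0 <= (1 - th) * / (2 * b)); [|lra].
      apply Rmult_le_pos; [lra|]. left; apply Rinv_0_lt_compat; lra. }
  eapply Rle_trans with (rsum n (fun tau => A * rpow (U tau) (/ (2 * a)) + (1 - A) * V tau)).
  - apply rsum_le. intros tau _.
    eapply Rle_trans; [apply rpow_le; [|apply HR]|].
    + left; apply Rinv_0_lt_compat; lra.
    + rewrite rpow_mult by apply rpow_ge0. rewrite !rpow_rpow.
      rewrite <- EA.
      replace (th * / (2 * b)) with (/ (2 * a) * A) by (unfold A; field; lra).
      rewrite <- rpow_rpow. apply young; auto; apply rpow_ge0.
  - rewrite rsum_plus, !rsum_scal.
    assert (A * rsum n (fun i => rpow (U i) (/ (2 * a))) <= A * 1) by (apply Rmult_le_compat_l; [lra|auto]).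
    assert ((1 - A) * rsum n V <= (1 - A) * 1) by (apply Rmult_le_compat_l; [lra|auto]).
    lra.
Qed.

(* Blei's interpolation; 1/rho is the average of 1/lambda = a and of m-1 copies of 1/2. *)
Lemma blei n m a F : (0 < m)%nat -> / 2 <= a -> (forall i, 0 <= F i) ->
  (forall j, (j < m)%nat -> rsum n (fun tau => rpow (marg n m j tau F) (/ (2 * a))) <= 1) ->
  tot n m (fun idx => rpow (F idx) (INR m / (2 * a + (INR m - 1)))) <= 1.
Proof.
  intros Hm Ha HF H.
  assert (HM : 1 <= INR m) by (apply (le_INR 1); lia).
  set (R := fun j tau => marg n m j tau F) in *.
  assert (HR : forall j tau, 0 <= R j tau) by (intros; apply marg_nonneg; auto).
  (* For a = 1 - |1/p| this is rho/2, to be applied to squared coefficients. *)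
  set (th := INR m / (2 * a + (INR m - 1))).
  assert (Hth : 0 <= th <= 1).
  { unfold th. split.
    - apply Rle_mult_inv_pos; lra.
    - apply (Rmult_le_reg_r (2 * a + (INR m - 1))); [lra|].
      replace (INR m / (2 * a + (INR m - 1)) * (2 * a + (INR m - 1))) with (INR m) by (field; lra). lra. }
  (* With this exponent, R_j^(-de) F sums along slot j to the sum of R_j^(1/(2a)), which the
     hypothesis bounds by 1. *)
  set (de := 1 - / (2 * a)).
  assert (Hpt : forall idx, in_box n 0 m zidx idx ->
    rpow (F idx) th <= th * (/ INR m * rsum m (fun j => rpow (R j (idx j)) (- de) * F idx))
      + (1 - th) * rprodr 0 m (fun j => rpow (R j (idx j)) (/ (2 * a)))).
  { intros idx Hb.
    destruct (Req_dec (F idx) 0) as [E|HF0].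
    { rewrite rpow_zero by lra. apply Rplus_le_le_0_compat.
      - apply Rmult_le_pos; [lra|]. apply Rmult_le_pos; [left; apply Rinv_0_lt_compat; lra|].
        apply rsum_nonneg. intros. apply Rmult_le_pos; auto; apply rpow_ge0.
      - apply Rmult_le_pos; [lra|]. apply rprodr_nonneg. intros; apply rpow_ge0. }
    assert (HFp : 0 < F idx) by (specialize (HF idx); lra).
    assert (HRp : forall j, (j < m)%nat -> 0 < R j (idx j)).
    { intros j Hj. assert (F idx <= R j (idx j)) by (apply marg_term_le; auto). lra. }
    set (P := rprodr 0 m (fun j => rpow (R j (idx j)) (/ (2 * a)))).
    (* Y is the geometric mean over j of F R_j^(-de). In Y^th P^(1-th) the powers of each R_j
       cancel, leaving F^th. Replacing Y by the arithmetic mean then gives terms involving a single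
       marginal each. *)
    set (Y := F idx * rprodr 0 m (fun j => rpow (R j (idx j)) (- de / INR m))).
    assert (HP : 0 < P) by (apply rprodr_pos; intros; apply rpow_gt0, HRp; lia).
    assert (HY : 0 < Y).
    { apply Rmult_lt_0_compat; auto. apply rprodr_pos; intros; apply rpow_gt0, HRp; lia. }
    assert (E : rpow (F idx) th = rpow Y th * rpow P (1 - th)).
    { unfold Y, P. rewrite rpow_mult; [|auto|apply rprodr_nonneg; intros; apply rpow_ge0].
      rewrite !rprodr_rpow by (intros; apply rpow_ge0).
      rewrite Rmult_assoc, <- rprodr_mult.
      rewrite (rprodr_ext m 0 _ (fun _ => 1)).
      - assert (E1 : forall d l, rprodr l d (fun _ => 1) = 1).
        { induction d; intros; simpl; auto. rewrite IHd; lra. }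
        rewrite E1. lra.
      - intros i Hi. rewrite !rpow_rpow, <- rpow_plus.
        replace (- de / INR m * th + / (2 * a) * (1 - th)) with 0.
        + apply rpow_0, HRp; lia.
        + unfold de, th. field. repeat split; lra. }
    rewrite E. eapply Rle_trans; [apply young; lra|].
    apply Rplus_le_compat_r. apply Rmult_le_compat_l; [lra|].
    unfold Y.
    rewrite (rprodr_ext m 0 _ (fun j => rpow (rpow (R j (idx j)) (- de)) (/ INR m)))
      by (intros; rewrite rpow_rpow; reflexivity).
    eapply Rle_trans.
    - apply Rmult_le_compat_l; [lra|]. apply amgm; auto. intros; apply rpow_gt0; auto.
    - right. rewrite (rsum_ext m (fun j => rpow (R j (idx j)) (- de) * F idx)
        (fun j => F idx * rpow (R j (idx j)) (- de))) by (intros; ring).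
      rewrite rsum_scal. ring. }
  eapply Rle_trans; [apply msum_le, Hpt|].
  rewrite msum_plus, !msum_scal, msum_rsum_swap.
  (* Each factor depends on its own index only, so the sum of the products is the product of the
     sums. *)
  rewrite (msum_prod n m 0 (fun j tau => rpow (R j tau) (/ (2 * a)))).
  assert (B1 : rsum m (fun j => tot n m (fun idx => rpow (R j (idx j)) (- de) * F idx)) <= INR m).
  { rewrite <- (Rmult_1_r (INR m)), <- rsum_const. apply rsum_le. intros j Hj.
    rewrite <- (rsum_marg n m j F (fun t => rpow (R j t) (- de))) by auto.
    eapply Rle_trans; [|apply (H j Hj)]. right. apply rsum_ext. intros i Hi. fold (R j i).
    rewrite <- (rpow_1 (R j i)) at 2 by apply HR. rewrite <- rpow_plus. f_equal. unfold de; ring. }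
  assert (B2 : rprodr 0 m (fun j => rsum n (fun tau => rpow (R j tau) (/ (2 * a)))) <= 1).
  { apply rprodr_le_1. intros i Hi. split; [apply rsum_nonneg; intros; apply rpow_ge0|].
    apply H; lia. }
  assert (B3 : / INR m * rsum m (fun j => tot n m (fun idx => rpow (R j (idx j)) (- de) * F idx)) <= 1).
  { apply (Rmult_le_compat_l (/ INR m)) in B1; [|left; apply Rinv_0_lt_compat; lra].
    rewrite Rinv_l in B1 by lra. exact B1. }
  assert (C1 := Rmult_le_compat_l th _ _ ltac:(lra) B3).
  assert (C2 := Rmult_le_compat_l (1 - th) _ _ ltac:(lra) B2).
  lra.
Qed.

(** * Khinchine's inequality for quadratic forms *)

(** A nonnegative quadratic form, recorded only through its expansion along lines and the
    Cauchy-Schwarz bound for the cross term. This is all that the moment computation uses, and it is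
    stable under sums. *)
Definition quad (Q : (nat -> R) -> R) : Prop :=
  (forall u, 0 <= Q u) /\
  forall u v, exists B, B * B <= Q u * Q v /\
    forall c, Q (fun i => u i + c * v i) = Q u + 2 * c * B + c * c * Q v.

Lemma quad_zero : quad (fun _ => 0).
Proof. split; [intros; lra|]. intros u v. exists 0. split; intros; lra. Qed.

(** Cross terms add. Cauchy-Schwarz survives because 2BC is at most P u Q v + Q u P v, by the
    arithmetic-geometric mean inequality. *)
Lemma quad_plus P Q : quad P -> quad Q -> quad (fun u => P u + Q u).
Proof.
  intros [HP HP2] [HQ HQ2]. split.
  - intros u. specialize (HP u). specialize (HQ u). lra.
  - intros u v. destruct (HP2 u v) as [B [HB EB]]. destruct (HQ2 u v) as [C [HC EC]].
    exists (B + C). split.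
    + assert (H1 := HP u). assert (H2 := HP v). assert (H3 := HQ u). assert (H4 := HQ v).
      assert (2 * (B * C) <= P u * Q v + Q u * P v).
      { set (x := P u * Q v). set (y := Q u * P v).
        assert (0 <= x) by (apply Rmult_le_pos; auto).
        assert (0 <= y) by (apply Rmult_le_pos; auto).
        assert (HBC : (B * C) * (B * C) <= x * y).
        { replace (B * C * (B * C)) with (B * B * (C * C)) by ring.
          replace (x * y) with (P u * P v * (Q u * Q v)) by (unfold x, y; ring).
          apply Rmult_le_compat; auto; nra. }
        apply Rsqr_incr_0_var; [unfold Rsqr|lra].
        assert (Hsq := Rle_0_sqr (x - y)). unfold Rsqr in Hsq. clearbody x y. nra. }
      nra.
    + intros c. rewrite EB, EC. ring.
Qed.

Lemma quad_rsum n (Q : nat -> (nat -> R) -> R) :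
  (forall i, (i < n)%nat -> quad (Q i)) -> quad (fun u => rsum n (fun i => Q i u)).
Proof.
  induction n; intros H; simpl; [apply quad_zero|]. apply quad_plus; auto.
Qed.

Lemma quad_0 Q : quad Q -> Q (fun _ => 0) = 0.
Proof.
  intros [_ H]. destruct (H (fun _ => 0) (fun _ => 0)) as [B [_ E]].
  assert (E1 := E 1). assert (E2 := E (-1)).
  replace (fun i : nat => 0 + 1 * 0) with (fun _ : nat => 0) in E1
    by (apply functional_extensionality; intros; ring).
  replace (fun i : nat => 0 + -1 * 0) with (fun _ : nat => 0) in E2
    by (apply functional_extensionality; intros; ring).
  lra.
Qed.

Notation ek := (ebasis KR).

(* Average of f over the signs in coordinates below k, the other ones being those of v. *)
Fixpoint av (k : nat) (f : (nat -> R) -> R) (v : nat -> R) : R :=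
  match k with
  | O => f v
  | S k' => (av k' f (updv v k' 1) + av k' f (updv v k' (-1))) / 2
  end.

Lemma av_le k : forall f g v, (forall u, f u <= g u) -> av k f v <= av k g v.
Proof.
  induction k; intros f g v H; simpl; auto.
  assert (H1 := IHk f g (updv v k 1) H). assert (H2 := IHk f g (updv v k (-1)) H). lra.
Qed.

Lemma av_lin k : forall f g a b v,
  av k (fun u => a * f u + b * g u) v = a * av k f v + b * av k g v.
Proof. induction k; intros; simpl; auto. rewrite !IHk. field. Qed.

Lemma av_zero k : forall v, av k (fun _ => 0) v = 0.
Proof. induction k; intros; simpl; auto. rewrite !IHk. field. Qed.

Lemma av_rsum k N : forall (f : nat -> (nat -> R) -> R) v,
  av k (fun u => rsum N (fun t => f t u)) v = rsum N (fun t => av k (f t) v).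
Proof.
  intros f v. induction N; simpl; [apply av_zero|].
  rewrite <- IHN.
  pose proof (av_lin k (fun u => rsum N (fun t => f t u)) (f N) 1 1 v) as E.
  rewrite !Rmult_1_l in E. rewrite <- E. f_equal.
  apply functional_extensionality. intros; ring.
Qed.

(** At each coordinate, one of the two signs does at least as well as the average of both. *)
Lemma av_exists k : forall f v, exists u,
  (forall i, (i < k)%nat -> u i = 1 \/ u i = -1) /\
  (forall i, (k <= i)%nat -> u i = v i) /\ av k f v <= f u.
Proof.
  induction k; intros f v; simpl.
  - exists v. repeat split; intros; [lia|lra].
  - assert (H : exists s, (s = 1 \/ s = -1) /\
      (av k f (updv v k 1) + av k f (updv v k (-1))) / 2 <= av k f (updv v k s)).
    { destruct (Rle_dec (av k f (updv v k 1)) (av k f (updv v k (-1)))).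
      - exists (-1). split; [auto|lra].
      - exists 1. split; [auto|lra]. }
    destruct H as [s [Hs Hle]]. destruct (IHk f (updv v k s)) as [u [H1 [H2 H3]]].
    exists u. split; [|split].
    + intros i Hi. destruct (Nat.eq_dec i k) as [->|]; [|apply H1; lia].
      rewrite H2 by lia. rewrite updv_same. auto.
    + intros i Hi. rewrite H2 by lia. apply updv_other; lia.
    + lra.
Qed.

Lemma updv_add v k c : v k = 0 -> updv v k c = fun i => v i + c * ek k i.
Proof.
  intros H. apply functional_extensionality. intros i. unfold updv, ebasis. simpl.
  destruct (Nat.eqb_spec i k) as [->|]; [rewrite H; ring|ring].
Qed.

(** The induction absorbs the last sign into the base point v, hence the general v. Averaging the
    squares of Q v + q + 2B and Q v + q - 2B gives (Q v + q)^2 + 4B^2, and 4B^2 <= 4 q Q v produces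
    the coefficient 6; the coefficient 3 then leaves room for q^2. *)
Lemma av_moments Q : quad Q -> forall k v, (forall i, (i < k)%nat -> v i = 0) ->
  av k Q v = Q v + rsum k (fun i => Q (ek i)) /\
  av k (fun u => Q u * Q u) v <= Q v * Q v + 6 * Q v * rsum k (fun i => Q (ek i))
     + 3 * rsum k (fun i => Q (ek i)) * rsum k (fun i => Q (ek i)).
Proof.
  intros HQ. assert (HQ' := HQ). destruct HQ' as [Hpos HB].
  induction k; intros v Hv; cbn [av rsum]; [split; lra|].
  set (S := rsum k (fun i => Q (ek i))) in *.
  assert (HS : 0 <= S) by (apply rsum_nonneg; auto).
  destruct (HB v (ek k)) as [B [HB1 HB2]].
  assert (Z : forall s i, (i < k)%nat -> updv v k s i = 0).
  { intros s i Hi. rewrite updv_other by lia. apply Hv; lia. }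
  destruct (IHk (updv v k 1) (Z 1)) as [E1 F1].
  destruct (IHk (updv v k (-1)) (Z (-1))) as [E2 F2].
  assert (G1 : Q (updv v k 1) = Q v + 2 * 1 * B + 1 * 1 * Q (ek k))
    by (rewrite updv_add by (apply Hv; lia); apply HB2).
  assert (G2 : Q (updv v k (-1)) = Q v + 2 * -1 * B + -1 * -1 * Q (ek k))
    by (rewrite updv_add by (apply Hv; lia); apply HB2).
  rewrite E1, E2. rewrite G1, G2 in *.
  assert (H1 := Hpos v). assert (H2 := Hpos (ek k)). set (q := Q (ek k)) in *. set (x := Q v) in *.
  split; [lra|].
  assert (0 <= q * S) by (apply Rmult_le_pos; auto).
  assert (0 <= q * q) by (apply Rmult_le_pos; auto).
  nra.
Qed.

(** With s = sqrt S, the square root dominates Q/(3s) - Q^2/(27 s^3) pointwise. As Q has mean s^2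
    and Q^2 has mean at most 3 s^4, the average is at least s/3 - s/9 = 2s/9. *)
Lemma khinchine n Q : quad Q ->
  2 / 9 * sqrt (rsum n (fun i => Q (ek i))) <= av n (fun u => sqrt (Q u)) (fun _ => 0).
Proof.
  intros HQ. destruct (av_moments Q HQ n (fun _ => 0)) as [E F]; auto.
  rewrite (quad_0 Q HQ) in *.
  set (S := rsum n (fun i => Q (ek i))) in *.
  assert (HS : 0 <= S) by (apply rsum_nonneg; intros; apply HQ).
  destruct (Req_dec S 0) as [E0|].
  { rewrite E0, sqrt_0, Rmult_0_r.
    apply Rle_trans with (av n (fun _ => 0) (fun _ => 0)); [rewrite av_zero; lra|].
    apply av_le. intros u. apply sqrt_pos. }
  set (s := sqrt S).
  assert (Hs : 0 < s) by (apply sqrt_lt_R0; lra).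
  assert (Es : S = s * s) by (symmetry; apply sqrt_sqrt; lra).
  eapply Rle_trans; [|apply (av_le n (fun u => / (3 * s) * Q u + - / (27 * s * s * s) * (Q u * Q u)))].
  - rewrite av_lin, E. eapply Rle_trans with (/ (3 * s) * (0 + S) + - / (27 * s * s * s) * (3 * S * S)).
    + rewrite Es. right. field. lra.
    + apply Rplus_le_compat_l. rewrite !Ropp_mult_distr_l_reverse. apply Ropp_le_contravar.
      apply Rmult_le_compat_l; [left; apply Rinv_0_lt_compat; repeat apply Rmult_lt_0_compat; lra|]. lra.
  - intros u. destruct HQ as [Hpos _]. specialize (Hpos u).
    set (t := sqrt (Q u)). assert (Ht : 0 <= t) by apply sqrt_pos.
    assert (Et : Q u = t * t) by (symmetry; apply sqrt_sqrt; lra).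
    rewrite Et.
    (* With t = 3 s v this is the inequality v^2 - v^4 <= v. *)
    set (v := t / (3 * s)). assert (Hv : 0 <= v) by (apply Rle_mult_inv_pos; lra).
    replace t with (3 * s * v) by (unfold v; field; lra).
    replace (/ (3 * s) * (3 * s * v * (3 * s * v)) +
      - / (27 * s * s * s) * (3 * s * v * (3 * s * v) * (3 * s * v * (3 * s * v))))
      with (3 * s * (v * (v - v * v * v))) by (field; lra).
    apply Rmult_le_compat_l; [lra|].
    assert (v - v * v * v <= 1).
    { destruct (Rle_dec v 1); [|nra]. assert (0 <= v * v * v) by (apply Rmult_le_pos; nra). lra. }
    nra.
Qed.

(** * Multilinear forms on real sequences *)

Lemma mlin_step m n (T : (nat -> nat -> R) -> R) (HT : multilinear KR m n T) j X (u v : nat -> R) c : (j < m)%nat ->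
  T (updv X j (fun l => u l + c * v l)) = T (updv X j u) + c * T (updv X j v).
Proof. intros Hj. exact (proj2 HT j X u v c Hj). Qed.

Lemma mlin_zero m n (T : (nat -> nat -> R) -> R) (HT : multilinear KR m n T) j X : (j < m)%nat ->
  T (updv X j (fun _ => 0)) = 0.
Proof.
  intros Hj. pose proof (mlin_step m n T HT j X (fun _ => 0) (fun _ => 0) (-1) Hj) as E.
  cbv beta in E.
  replace (fun _ : nat => 0 + -1 * 0) with (fun _ : nat => 0) in E
    by (apply functional_extensionality; intros; ring).
  lra.
Qed.

Lemma mlin_scal m n (T : (nat -> nat -> R) -> R) (HT : multilinear KR m n T) j X (v : nat -> R) c : (j < m)%nat ->
  T (updv X j (fun l => c * v l)) = c * T (updv X j v).
Proof.
  intros Hj. pose proof (mlin_step m n T HT j X (fun _ => 0) v c Hj) as E.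
  cbv beta in E.
  rewrite (mlin_zero m n T HT) in E by auto.
  replace (fun l : nat => 0 + c * v l) with (fun l : nat => c * v l) in E
    by (apply functional_extensionality; intros; ring).
  lra.
Qed.

Lemma mlin_expand m n (T : (nat -> nat -> R) -> R) (HT : multilinear KR m n T) j X (u : nat -> R) : (j < m)%nat ->
  T (updv X j u) = rsum n (fun i => u i * T (updv X j (ek i))).
Proof.
  intros Hj.
  assert (H : forall N, T (updv X j (fun l => if Nat.ltb l N then u l else 0))
    = rsum N (fun i => u i * T (updv X j (ek i)))).
  { induction N; cbn [rsum].
    - exact (mlin_zero m n T HT j X Hj).
    - rewrite <- IHN, <- (mlin_step m n T HT) by auto. f_equal. f_equal.
      apply functional_extensionality. intros l. unfold ebasis. simpl.
      destruct (Nat.eqb_spec l N), (Nat.ltb_spec l (S N)), (Nat.ltb_spec l N); subst; try lia; ring. }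
  rewrite <- H. apply (proj1 HT). intros i l Hi Hl. unfold updv.
  destruct (Nat.eqb i j); auto. destruct (Nat.ltb_spec l n); auto; lia.
Qed.

Lemma mlin_rescale m n (T : (nat -> nat -> R) -> R) (HT : multilinear KR m n T) (c : nat -> R) (Y : nat -> nat -> R) :
  forall d l, (l + d <= m)%nat ->
  T (fun i a => if (andb (l <=? i) (i <? l + d))%nat then c i * Y i a else Y i a)
  = rprodr l d c * T Y.
Proof.
  induction d; intros l Hl; cbn [rprodr].
  - rewrite Rmult_1_l. f_equal. apply functional_extensionality. intros i.
    apply functional_extensionality. intros a.
    destruct (Nat.leb_spec l i), (Nat.ltb_spec i (l + 0)); simpl; auto; lia.
  - set (Z := fun i a => if (andb (S l <=? i) (i <? S l + d))%nat then c i * Y i a else Y i a).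
    assert (EZ : T Z = rprodr (S l) d c * T Y) by (apply IHd; lia).
    rewrite Rmult_assoc, <- EZ.
    rewrite <- (updv_id Z l) at 1. rewrite <- (mlin_scal m n T HT) by lia.
    f_equal. apply functional_extensionality. intros i. unfold updv.
    apply functional_extensionality. intros a.
    destruct (Nat.eqb_spec i l) as [->|Hi]; unfold Z.
    + destruct (Nat.leb_spec l l), (Nat.ltb_spec l (l + S d)), (Nat.leb_spec (S l) l); simpl; try lia; ring.
    + destruct (Nat.leb_spec l i), (Nat.ltb_spec i (l + S d)), (Nat.leb_spec (S l) i),
        (Nat.ltb_spec i (S l + d)); simpl; try lia; auto.
Qed.

(** * Khinchine's inequality in all slots but one *)

(** Slot j keeps its vector, and slots outside the window may hold arbitrary ones; this mixture of
    sign vectors and canonical vectors occurs while Khinchine's inequality is applied slot by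
    slot. *)
Fixpoint sumb (n l d j : nat) (G : (nat -> nat -> R) -> R) (X : nat -> nat -> R) : R :=
  match d with
  | O => G X
  | S d' => if Nat.eqb l j then sumb n (S l) d' j G X
            else rsum n (fun i => sumb n (S l) d' j G (updv X l (ek i)))
  end.

Lemma quad_sumb m n (T : (nat -> nat -> R) -> R) (HT : multilinear KR m n T) j l : (l < m)%nat -> forall d l' X, (l < l')%nat ->
  quad (fun v => sumb n l' d j (fun X => T X * T X) (updv X l v)).
Proof.
  intros Hl. induction d; intros l' X Hl'; cbn [sumb].
  - split.
    + intros u. apply Rle_0_sqr.
    + intros u v. exists (T (updv X l u) * T (updv X l v)). split; [right; ring|].
      intros c. rewrite (mlin_step m n T HT) by auto. ring.
  - destruct (Nat.eqb l' j); [apply IHd; lia|].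
    apply (quad_rsum n (fun i v => sumb n (S l') d j (fun X0 => T X0 * T X0) (updv (updv X l v) l' (ek i)))).
    intros i Hi.
    replace (fun v => sumb n (S l') d j (fun X0 => T X0 * T X0) (updv (updv X l v) l' (ek i)))
      with (fun v => sumb n (S l') d j (fun X0 => T X0 * T X0) (updv (updv X l' (ek i)) l v)).
    + apply IHd; lia.
    + apply functional_extensionality. intros v. rewrite updv_comm by lia. reflexivity.
Qed.

Definition is_sign (x : R) : Prop := x = 1 \/ x = -1.

(** In each slot other than j, the square sum over canonical vectors is replaced by the value at one
    sign vector, at the cost 9/2. When no slot is left, the square root of T^2 is |T|. *)
Lemma khinchine_slots m n (T : (nat -> nat -> R) -> R) (HT : multilinear KR m n T) j : (j < m)%nat ->
  forall d l X, (l + d <= m)%nat -> exists Y : nat -> nat -> R,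
   (forall i, (i < l)%nat \/ (l + d <= i)%nat -> Y i = X i) /\
   (forall i a, (l <= i < l + d)%nat -> i <> j -> (a < n)%nat -> is_sign (Y i a)) /\
   rsum n (fun tau => sqrt (sumb n l d j (fun X => T X * T X) (updv X j (ek tau))))
   <= (9 / 2) ^ d * rsum n (fun tau => Rabs (T (updv Y j (ek tau)))).
Proof.
  intros Hj. induction d; intros l X Hl.
  - exists X. split; [auto|]. split; [intros; lia|]. simpl. rewrite Rmult_1_l. right.
    apply rsum_ext. intros. apply sqrt_Rsqr_abs.
  - assert (P9 : 0 < (9 / 2) ^ d) by (apply pow_lt; lra).
    destruct (Nat.eq_dec l j) as [->|Hlj].
    (* Slot j is not randomised; the factor 9/2 is simply given away. *)
    + destruct (IHd (S j) X ltac:(lia)) as [Y [H1 [H2 H3]]].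
      exists Y. split; [intros; apply H1; lia|]. split; [intros; apply H2; auto; lia|].
      cbn [sumb]. rewrite Nat.eqb_refl. eapply Rle_trans; [exact H3|].
      apply Rmult_le_compat_r.
      * apply rsum_nonneg. intros; apply Rabs_pos.
      * simpl. lra.
    + set (Q := fun tau v => sumb n (S l) d j (fun X => T X * T X) (updv (updv X j (ek tau)) l v)).
      assert (HQ : forall tau, quad (Q tau)) by (intros; apply (quad_sumb m); auto; lia).
      (* The sum over tau is averaged as a whole, so that one sign vector e serves all tau at
         once. *)
      destruct (av_exists n (fun u => rsum n (fun tau => sqrt (Q tau u))) (fun _ => 0))
        as [e [He [_ Hav]]].
      rewrite (av_rsum n n (fun tau u => sqrt (Q tau u))) in Hav.
      destruct (IHd (S l) (updv X l e) ltac:(lia)) as [Y [H1 [H2 H3]]].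
      exists Y. split; [|split].
      * intros i Hi. rewrite H1 by lia. apply updv_other; lia.
      * intros i a Hi Hij Ha. destruct (Nat.eq_dec i l) as [->|].
        -- rewrite H1 by lia. rewrite updv_same. apply He; auto.
        -- apply H2; auto; lia.
      * assert (Hk : 2 / 9 * rsum n (fun tau => sqrt (rsum n (fun i => Q tau (ek i))))
           <= rsum n (fun tau => sqrt (Q tau e))).
        { eapply Rle_trans; [|exact Hav]. rewrite <- rsum_scal. apply rsum_le.
          intros. apply khinchine; auto. }
        cbn [sumb]. apply Nat.eqb_neq in Hlj as Hlj'. rewrite Hlj'.
        assert (E : rsum n (fun tau => sqrt (Q tau e)) =
           rsum n (fun tau => sqrt (sumb n (S l) d j (fun X => T X * T X) (updv (updv X l e) j (ek tau))))).
        { apply rsum_ext. intros. unfold Q. rewrite updv_comm by auto. reflexivity. }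
        rewrite E in Hk. unfold Q in Hk. simpl pow. lra.
Qed.

Definition Eidx (idx : nat -> nat) : nat -> nat -> R := fun i => ek (idx i).

Lemma Eidx_updv idx l i : updv (Eidx idx) l (ek i) = Eidx (updv idx l i).
Proof.
  apply functional_extensionality. intros a. unfold Eidx, updv. destruct (Nat.eqb a l); auto.
Qed.

Lemma sumb_msum n j tau G d : (tau < n)%nat -> forall l idx, idx j = tau ->
  sumb n l d j G (Eidx idx)
  = msum n l d (fun i => if Nat.eqb (i j) tau then G (Eidx i) else 0) idx.
Proof.
  intros Ht. induction d; intros l idx Hi; simpl.
  - rewrite Hi, Nat.eqb_refl. reflexivity.
  - destruct (Nat.eqb_spec l j) as [->|Hlj].
    + rewrite (rsum_ext n (fun i => msum n (S j) d _ (updv idx j i))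
        (fun i => if Nat.eqb i tau then sumb n (S j) d j G (Eidx idx) else 0)).
      * rewrite (rsum_pick n tau (fun _ => sumb n (S j) d j G (Eidx idx))); auto.
      * intros i Hin. destruct (Nat.eqb_spec i tau) as [->|Hit].
        -- assert (E : updv idx j tau = idx) by (rewrite <- Hi; apply updv_id).
           rewrite E, IHd; auto.
        -- rewrite (msum_ext _ _ _ _ (fun _ => 0)); [apply msum_zero|].
           intros idx' Hb. apply in_box_step in Hb; auto. destruct Hb as [_ ->].
           destruct (Nat.eqb_spec i tau); [lia|auto].
    + apply rsum_ext. intros i Hin. rewrite Eidx_updv. apply IHd. rewrite updv_other by auto. auto.
Qed.

Lemma sumb_marg n m j tau G X0 : (j < m)%nat -> (tau < n)%nat -> X0 = Eidx zidx ->
  sumb n 0 m j G (updv X0 j (ek tau)) = marg n m j tau (fun i => G (Eidx i)).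
Proof.
  intros Hj Ht ->. rewrite Eidx_updv, (sumb_msum n j tau); auto.
  - unfold marg. apply msum_base. intros i Hi. apply updv_other; lia.
  - apply updv_same.
Qed.

(** After Khinchine the remaining l_1 sum over slot j is a single value of T at sign vectors: the
    signs of its terms are placed in slot j. *)
Lemma form_bound_12 m n (T : (nat -> nat -> R) -> R) (HT : multilinear KR m n T) N :
  (forall X, (forall j a, (j < m)%nat -> (a < n)%nat -> is_sign (X j a)) -> Rabs (T X) <= N) ->
  forall j, (j < m)%nat ->
  rsum n (fun tau => sqrt (marg n m j tau (fun i => T (Eidx i) * T (Eidx i)))) <= (9 / 2) ^ m * N.
Proof.
  intros HN j Hj.
  destruct (khinchine_slots m n T HT j Hj m 0 (Eidx zidx) ltac:(lia)) as [Y [_ [H2 H3]]].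
  rewrite (rsum_ext n _ (fun tau => sqrt (marg n m j tau (fun i => T (Eidx i) * T (Eidx i))))) in H3.
  2:{ intros. rewrite (sumb_marg n m j i (fun X => T X * T X)); auto. }
  eapply Rle_trans; [exact H3|]. apply Rmult_le_compat_l; [apply pow_le; lra|].
  set (sg := fun tau => if Rle_dec 0 (T (updv Y j (ek tau))) then 1 else -1).
  rewrite (rsum_ext n _ (fun tau => sg tau * T (updv Y j (ek tau)))).
  - rewrite <- (mlin_expand m n T HT) by auto.
    eapply Rle_trans; [apply Rle_abs|]. apply HN. intros i a Hi Ha.
    destruct (Nat.eq_dec i j) as [->|].
    + rewrite updv_same. unfold sg, is_sign. destruct Rle_dec; [left|right]; reflexivity.
    + rewrite updv_other by auto. apply H2; auto; lia.
  - intros i Hi. unfold sg. destruct Rle_dec; [rewrite Rabs_pos_eq; lra|rewrite Rabs_left; lra].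
Qed.

(** * The Hardy-Littlewood inequality *)

Lemma sabs_ge0 k x : 0 <= sabs k x.
Proof. destruct k; [apply Rabs_pos|apply sqrt_pos]. Qed.

Lemma supnorm_le k n x c : 0 <= c -> (forall i, (i < n)%nat -> sabs k (x i) <= c) ->
  supnorm k n x <= c.
Proof. induction n; intros Hc H; simpl; auto. apply Rmax_lub; auto. Qed.

Lemma supnorm_ge k n x i : (i < n)%nat -> sabs k (x i) <= supnorm k n x.
Proof.
  induction n; intros H; [lia|]. simpl. destruct (Nat.eq_dec i n) as [->|].
  - apply Rmax_r.
  - eapply Rle_trans; [apply IHn; lia|apply Rmax_l].
Qed.

(* The squares of the moduli of the vectors of the unit ball of l_p. *)
Definition sqball (n : nat) (p : ExtR) (v : nat -> R) : Prop :=
  (forall i, 0 <= v i) /\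
  match p with
  | Fin q => rsum n (fun i => rpow (v i) (q / 2)) <= 1
  | Inf => forall i, (i < n)%nat -> v i <= 1
  end.

Lemma sqball_lpnorm n p v s : ge2 p -> sqball n p v ->
  (forall i, (i < n)%nat -> is_sign (s i)) ->
  lpnorm KR n p (fun i => sqrt (v i) * s i) <= 1.
Proof.
  intros Hp [Hv Hb] Hs.
  assert (E : forall i, (i < n)%nat -> Rabs (sqrt (v i) * s i) = sqrt (v i)).
  { intros i Hi. rewrite Rabs_mult, (Rabs_pos_eq (sqrt _)) by apply sqrt_pos.
    destruct (Hs i Hi) as [-> | ->].
    - rewrite Rabs_R1; ring.
    - rewrite Rabs_left by lra; ring. }
  destruct p as [q|]; simpl in *.
  - apply rpow_le_1; [apply Rle_mult_inv_pos; lra|].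
    eapply Rle_trans; [|exact Hb]. right. apply rsum_ext. intros i Hi.
    rewrite E, <- rpow_half, rpow_rpow by auto. f_equal. field.
  - apply supnorm_le; [lra|]. intros i Hi. simpl. rewrite E by auto.
    rewrite <- sqrt_1. apply sqrt_le_1_alt; auto.
Qed.

Lemma scale_updv (s : nat -> nat -> R) X j (u : nat -> R) :
  (fun l i => s l i * updv X j u l i) = updv (fun l i => s l i * X l i) j (fun i => s j i * u i).
Proof.
  apply functional_extensionality. intros l. unfold updv.
  apply functional_extensionality. intros i. destruct (Nat.eqb_spec l j) as [->|]; reflexivity.
Qed.

Lemma mlin_diag m n (T : (nat -> nat -> R) -> R) (HT : multilinear KR m n T) s :
  multilinear KR m n (fun X => T (fun l i => s l i * X l i)).
Proof.
  split.
  - intros X Y H. apply (proj1 HT). intros j l Hj Hl. f_equal. apply H; auto.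
  - intros j X u v c Hj. simpl. rewrite !scale_updv.
    rewrite <- (mlin_step m n T HT) by auto. f_equal. f_equal.
    apply functional_extensionality. intros i. ring.
Qed.

Lemma mlin_diag_Eidx m n (T : (nat -> nat -> R) -> R) (HT : multilinear KR m n T) s idx :
  T (fun l i => s l i * Eidx idx l i) = rprodr 0 m (fun l => s l (idx l)) * T (Eidx idx).
Proof.
  rewrite <- (mlin_rescale m n T HT) by lia. apply (proj1 HT). intros l i Hl Hi.
  destruct (Nat.leb_spec 0 l), (Nat.ltb_spec l (0 + m)); try lia. cbn [andb].
  unfold Eidx, ebasis. simpl. destruct (Nat.eqb_spec i (idx l)) as [->|]; ring.
Qed.

Lemma rprodr_updv (w : nat -> nat -> R) k v idx : (forall t, w k t = 1) -> forall d l, (l <= k < l + d)%nat ->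
  rprodr l d (fun i => updv w k v i (idx i)) = v (idx k) * rprodr l d (fun i => w i (idx i)).
Proof.
  intros Hw. induction d; intros l Hl; [lia|]. cbn [rprodr].
  destruct (Nat.eq_dec l k) as [->|Hlk].
  - rewrite updv_same, Hw.
    rewrite (rprodr_ext d (S k) (fun i => updv w k v i (idx i)) (fun i => w i (idx i))); [ring|].
    intros i Hi. rewrite updv_other by lia. reflexivity.
  - rewrite IHd by lia. rewrite updv_other by auto. ring.
Qed.

Lemma invp_ge0 p : ge2 p -> 0 <= invp p.
Proof. destruct p; simpl; intros; [apply Rle_mult_inv_pos; lra|lra]. Qed.

Lemma rsum_mono_n n m f : (n <= m)%nat -> (forall i, (i < m)%nat -> 0 <= f i) -> rsum n f <= rsum m f.
Proof.
  intros H Hf. induction H; [lra|]. simpl.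
  assert (0 <= f m) by auto. assert (rsum n f <= rsum m f) by auto. lra.
Qed.

Section RealHL.
Variables (m n : nat) (p : nat -> ExtR) (T : (nat -> nat -> R) -> R) (N : R).
Hypotheses (Hp : forall j, (j < m)%nat -> ge2 (p j)) (Hs : invp_sum m p <= 1 / 2)
  (HT : multilinear KR m n T) (HN : 0 < N)
  (Hb : forall X, (forall j, (j < m)%nat -> lpnorm KR n (p j) (X j) <= 1) -> Rabs (T X) <= N).

Let M := (9 / 2) ^ m * N.
Let F := fun idx => (T (Eidx idx) / M) * (T (Eidx idx) / M).

Lemma norm_const_pos : 0 < M.
Proof. apply Rmult_lt_0_compat; auto. apply pow_lt; lra. Qed.

Lemma coeff_sq_ge0 idx : 0 <= F idx.
Proof. apply Rle_0_sqr. Qed.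

(** The form X -> T(sqrt(w) X) is bounded by N on sign vectors, since each sqrt(w_l) times signs
    lies in the unit ball of l_{p_l}. Its squared coefficients are those of T times the product of
    the weights. *)
Lemma weighted_12 w : (forall l, (l < m)%nat -> sqball n (p l) (w l)) ->
  forall j, (j < m)%nat ->
  rsum n (fun tau => sqrt (marg n m j tau (fun idx => F idx * rprodr 0 m (fun l => w l (idx l))))) <= 1.
Proof.
  intros Hw j Hj.
  set (s := fun l i => sqrt (w l i)).
  pose proof (form_bound_12 m n _ (mlin_diag m n T HT s) N) as H.
  cbv beta in H. lapply H; clear H.
  2:{ intros X HX. apply Hb. intros i Hi. unfold s. apply sqball_lpnorm; auto. }
  intros H. specialize (H j Hj). fold M in H.
  assert (HM := norm_const_pos).
  rewrite (rsum_ext n _ (fun tau => / M * sqrt (marg n m j tau (fun i =>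
     T (fun l a => s l a * Eidx i l a) * T (fun l a => s l a * Eidx i l a))))).
  - rewrite rsum_scal. apply (Rmult_le_reg_l M); auto. rewrite <- Rmult_assoc, Rinv_r by lra. lra.
  - intros tau _.
    set (A := marg n m j tau (fun i => T (fun l a => s l a * Eidx i l a) * T (fun l a => s l a * Eidx i l a))).
    assert (HA : 0 <= A) by (apply marg_nonneg; intros; apply Rle_0_sqr).
    rewrite <- (sqrt_square (/ M)) by (left; apply Rinv_0_lt_compat; auto).
    rewrite <- sqrt_mult; auto; [|apply Rle_0_sqr]. f_equal.
    unfold A, marg. rewrite <- msum_scal. apply msum_ext. intros idx Hbx.
    destruct Nat.eqb; [|ring].
    rewrite (mlin_diag_Eidx m n T HT s). unfold F, s.
    set (q := rprodr 0 m (fun l => sqrt (w l (idx l)))).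
    replace (rprodr 0 m (fun l => w l (idx l))) with (q * q).
    + unfold Rdiv. ring.
    + unfold q. rewrite <- rprodr_mult. apply rprodr_ext. intros i Hi. apply sqrt_sqrt.
      apply Hw; lia.
Qed.

(** Induction on the number k of slots already freed of their weights. The weights of the later
    slots stay arbitrary, so that the induction hypothesis can be used for every weight v placed in
    slot k, as [lift_exponent] requires. *)
Lemma weighted_lambda k : (k <= m)%nat -> forall w,
  (forall l i, (l < k)%nat -> w l i = 1) ->
  (forall l, (k <= l < m)%nat -> sqball n (p l) (w l)) ->
  forall j, (j < m)%nat ->
  rsum n (fun tau => rpow (marg n m j tau (fun idx => F idx * rprodr 0 m (fun l => w l (idx l))))
     (/ (2 * (1 - rsum k (fun l => invp (p l)))))) <= 1.
Proof.
  assert (Hpart : forall k, (k <= m)%nat -> rsum k (fun l => invp (p l)) <= 1 / 2).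
  { intros k' Hk'. eapply Rle_trans; [|exact Hs]. apply rsum_mono_n; auto.
    intros; apply invp_ge0; auto. }
  assert (HG : forall w, (forall l i, (l < m)%nat -> 0 <= w l i) ->
    forall idx, 0 <= F idx * rprodr 0 m (fun l => w l (idx l))).
  { intros w Hw idx. apply Rmult_le_pos; [apply coeff_sq_ge0|]. apply rprodr_nonneg. intros; apply Hw; lia. }
  induction k; intros Hk w Hw1 Hw2 j Hj.
  - cbn [rsum]. replace (/ (2 * (1 - 0))) with (/ 2) by (f_equal; ring).
    eapply Rle_trans; [right|apply (weighted_12 w) with (j := j); auto].
    + apply rsum_ext. intros i Hi. apply rpow_half. apply marg_nonneg. apply HG.
      intros l a Hl. apply Hw2; lia.
    + intros; apply Hw2; lia.
  - specialize (IHk ltac:(lia)).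
    assert (Hk1 := Hpart (S k) Hk). cbn [rsum] in *.
    destruct (p k) as [q|] eqn:Epk.
    + assert (Hq : 2 <= q) by (specialize (Hp k ltac:(lia)); rewrite Epk in Hp; exact Hp).
      cbn [invp] in *.
      set (a := 1 - rsum k (fun l => invp (p l))) in *.
      replace (1 - (rsum k (fun l => invp (p l)) + 1 / q)) with (a - / q) by (unfold a; lra).
      apply lift_exponent with (k := k); auto; try lra.
      * unfold a; lra.
      * apply HG. intros l i Hl. destruct (Nat.lt_ge_cases l (S k)).
        -- rewrite Hw1 by auto; lra.
        -- apply Hw2; lia.
      * intros v Hv Hv1 j' Hj'.
        eapply Rle_trans; [right|apply (IHk (updv w k v)) with (j := j'); auto].
        -- apply rsum_ext. intros i Hi. f_equal. apply marg_ext. intros idx _.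
           rewrite (rprodr_updv w k v idx); [ring|intros; apply Hw1; lia|lia].
        -- intros l i Hl. rewrite updv_other by lia. apply Hw1; lia.
        -- intros l Hl. destruct (Nat.eq_dec l k) as [->|].
           ++ rewrite updv_same, Epk. split; auto.
           ++ rewrite updv_other by auto. apply Hw2; lia.
    (* For p_k infinite the constant weight 1 is itself admissible, and the exponent does not
       change. *)
    + cbn [invp]. rewrite Rplus_0_r. apply IHk; auto.
      intros l Hl. destruct (Nat.eq_dec l k) as [->|]; [|apply Hw2; lia].
      rewrite Epk. split; intros; rewrite Hw1 by lia; lra.
Qed.

Lemma real_hardy_littlewood : (0 < m)%nat ->
  tot n m (fun idx => rpow (Rabs (T (Eidx idx))) (rhoHL m p)) <= rpow M (rhoHL m p).
Proof.
  intros Hm. assert (HM := norm_const_pos).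
  assert (HMm : 1 <= INR m) by (apply (le_INR 1); lia).
  pose proof (blei n m (1 - invp_sum m p) F Hm ltac:(lra) coeff_sq_ge0) as H.
  lapply H; clear H.
  2:{ intros j Hj. pose proof (weighted_lambda m (le_n m) (fun _ _ => 1)) as H.
      eapply Rle_trans; [right|apply (H ltac:(auto) ltac:(intros; lia) j Hj)].
      apply rsum_ext. intros i Hi. f_equal. apply marg_ext. intros idx _.
      assert (E1 : forall d l, rprodr l d (fun _ => 1) = 1).
      { induction d; intros; simpl; auto. rewrite IHd; lra. }
      rewrite E1; ring. }
  intros H.
  rewrite (msum_ext _ _ _ _ (fun idx => rpow M (rhoHL m p) * rpow (F idx) (INR m / (2 * (1 - invp_sum m p) + (INR m - 1))))).
  - rewrite msum_scal. rewrite <- (Rmult_1_r (rpow M _)) at 2. apply Rmult_le_compat_l; auto. apply rpow_ge0.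
  - intros idx _.
    set (x := Rabs (T (Eidx idx)) / M).
    assert (Hx : 0 <= x) by (apply Rle_mult_inv_pos; auto; apply Rabs_pos).
    assert (EF : F idx = x * x).
    { pose proof (Rsqr_abs (T (Eidx idx))) as E. unfold Rsqr in E. unfold F, x, Rdiv.
      transitivity (T (Eidx idx) * T (Eidx idx) * (/ M * / M)); [ring|]. rewrite E. ring. }
    rewrite EF, rpow_mult, <- rpow_plus by auto.
    replace (INR m / (2 * (1 - invp_sum m p) + (INR m - 1)) + INR m / (2 * (1 - invp_sum m p) + (INR m - 1)))
      with (rhoHL m p) by (unfold rhoHL; field; repeat split; lra).
    rewrite <- rpow_mult by lra. f_equal. unfold x. field. lra.
Qed.
End RealHL.

Lemma rhoHL_ge1 m p : (1 <= m)%nat -> (forall j, (j < m)%nat -> ge2 (p j)) ->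
  invp_sum m p <= 1 / 2 -> 1 <= rhoHL m p.
Proof.
  intros Hm Hp Hs. assert (1 <= INR m) by (apply (le_INR 1); lia).
  assert (0 <= invp_sum m p) by (apply rsum_nonneg; intros; apply invp_ge0; auto).
  unfold rhoHL. apply (Rmult_le_reg_r (INR m + 1 - 2 * invp_sum m p)); [lra|].
  unfold Rdiv. rewrite Rmult_assoc, Rinv_l by lra. lra.
Qed.

Notation Eb k idx := (fun j : nat => ebasis k (idx j)).

(** In the complex case the real result is applied to the real and imaginary parts of T on real
    vectors. The factor 4 is 2 times 2: one from (x + y)^rho <= 2^rho (x^rho + y^rho), one from 2
    M^rho <= (2M)^rho, valid as rho >= 1. *)
Lemma hardy_littlewood k m n p T N : (1 <= m)%nat ->
  (forall j, (j < m)%nat -> ge2 (p j)) -> invp_sum m p <= 1 / 2 -> multilinear k m n T -> 0 < N ->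
  (forall X, (forall j, (j < m)%nat -> lpnorm k n (p j) (X j) <= 1) -> sabs k (T X) <= N) ->
  tot n m (fun idx => rpow (sabs k (T (Eb k idx))) (rhoHL m p))
    <= rpow (4 * (9 / 2) ^ m * N) (rhoHL m p).
Proof.
  intros Hm Hp Hs HT HN Hb.
  assert (Hr : 1 <= rhoHL m p) by (apply rhoHL_ge1; auto).
  assert (HM : 0 < (9 / 2) ^ m * N) by (apply Rmult_lt_0_compat; auto; apply pow_lt; lra).
  destruct k.
  - eapply Rle_trans; [apply (real_hardy_littlewood m n p T N); auto|].
    apply rpow_le; lra.
  - set (emb := fun (X : nat -> nat -> R) (j l : nat) => (X j l, 0)).
    assert (Habs : forall x : R, Cmod (x, 0) = Rabs x).
    { intros x. unfold Cmod. simpl. rewrite Rmult_0_l, Rplus_0_r. apply sqrt_Rsqr_abs. }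
    assert (Hemb : forall X, (forall j, (j < m)%nat -> lpnorm KR n (p j) (X j) <= 1) ->
       sabs KC (T (emb X)) <= N).
    { intros X HX. apply Hb. intros j Hj. specialize (HX j Hj).
      replace (lpnorm KC n (p j) (emb X j)) with (lpnorm KR n (p j) (X j)); auto.
      unfold emb. destruct (p j) as [q|]; cbn [lpnorm].
      - f_equal. apply rsum_ext. intros. cbn [sabs]. rewrite Habs. reflexivity.
      - clear. assert (E : forall N', supnorm KR N' (X j) = supnorm KC N' (fun l => (X j l, 0))).
        { induction N'; cbn [supnorm]; auto. rewrite IHN'. f_equal. cbn [sabs]. unfold Cmod. simpl.
          rewrite Rmult_0_l, Rplus_0_r. symmetry. apply sqrt_Rsqr_abs. }
        apply E. }
    assert (Hupd : forall X j u, emb (updv X j u) = updv (emb X) j (fun l => (u l, 0))).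
    { intros. apply functional_extensionality. intros i. unfold emb, updv.
      apply functional_extensionality. intros l. destruct (Nat.eqb i j); reflexivity. }
    assert (Hlin : forall j X (u v : nat -> R) c, (j < m)%nat ->
      T (emb (updv X j (fun l => u l + c * v l))) =
      Cadd (T (emb (updv X j u))) (Cmul (c, 0) (T (emb (updv X j v))))).
    { intros j X u v c Hj. rewrite !Hupd. rewrite <- (proj2 HT j (emb X) _ _ (c, 0) Hj).
      apply (f_equal (fun w => T (updv (emb X) j w))). apply functional_extensionality. intros l.
      unfold sadd, smul, Cadd, Cmul. simpl. f_equal; ring. }
    assert (Hext : forall X Y, (forall j l, (j < m)%nat -> (l < n)%nat -> X j l = Y j l) ->
      T (emb X) = T (emb Y)).
    { intros X Y H. apply (proj1 HT). intros j l Hj Hl. unfold emb. rewrite H; auto. }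
    assert (HTre : multilinear KR m n (fun X => fst (T (emb X)))).
    { split.
      - intros X Y H. rewrite (Hext X Y); auto.
      - intros j X u v c Hj. simpl sadd. simpl smul. rewrite Hlin by auto.
        unfold Cadd, Cmul. simpl. ring. }
    assert (HTim : multilinear KR m n (fun X => snd (T (emb X)))).
    { split.
      - intros X Y H. rewrite (Hext X Y); auto.
      - intros j X u v c Hj. simpl sadd. simpl smul. rewrite Hlin by auto.
        unfold Cadd, Cmul. simpl. ring. }
    assert (Hfst : forall z : R * R, Rabs (fst z) <= Cmod z).
    { intros z. rewrite <- sqrt_Rsqr_abs. apply sqrt_le_1_alt. unfold Rsqr.
      assert (0 <= snd z * snd z) by apply Rle_0_sqr. lra. }
    assert (Hsnd : forall z : R * R, Rabs (snd z) <= Cmod z).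
    { intros z. rewrite <- sqrt_Rsqr_abs. apply sqrt_le_1_alt. unfold Rsqr.
      assert (0 <= fst z * fst z) by apply Rle_0_sqr. lra. }
    assert (Hle : forall z : R * R, Cmod z <= Rabs (fst z) + Rabs (snd z)).
    { intros z. assert (H1 := Rabs_pos (fst z)). assert (H2 := Rabs_pos (snd z)).
      rewrite <- (sqrt_square (Rabs (fst z) + Rabs (snd z))) by lra.
      apply sqrt_le_1_alt.
      assert (E1 := Rsqr_abs (fst z)). assert (E2 := Rsqr_abs (snd z)). unfold Rsqr in *. nra. }
    assert (A1 := real_hardy_littlewood m n p _ N Hp Hs HTre HN
       (fun X HX => Rle_trans _ _ _ (Hfst _) (Hemb X HX)) ltac:(lia)).
    assert (A2 := real_hardy_littlewood m n p _ N Hp Hs HTim HN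
       (fun X HX => Rle_trans _ _ _ (Hsnd _) (Hemb X HX)) ltac:(lia)).
    cbv beta in A1, A2. set (rho := rhoHL m p) in *. set (M := (9 / 2) ^ m * N) in *.
    assert (Ebase : forall idx, T (Eb KC idx) = T (emb (Eidx idx))).
    { intros idx. apply (proj1 HT). intros j l _ _. unfold emb, Eidx, ebasis. simpl.
      destruct (Nat.eqb l (idx j)); reflexivity. }
    apply Rle_trans with (tot n m (fun idx => rpow 2 rho * (rpow (Rabs (fst (T (emb (Eidx idx))))) rho
       + rpow (Rabs (snd (T (emb (Eidx idx))))) rho))).
    + apply msum_le. intros idx _. cbn [sabs]. rewrite Ebase. set (z := T (emb (Eidx idx))).
      assert (H0 := Hle z). assert (P1 := Rabs_pos (fst z)). assert (P2 := Rabs_pos (snd z)).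
      assert (Q1 := rpow_ge0 (Rabs (fst z)) rho). assert (Q2 := rpow_ge0 (Rabs (snd z)) rho).
      assert (Q3 := rpow_ge0 2 rho).
      destruct (Rle_dec (Rabs (fst z)) (Rabs (snd z))).
      * apply Rle_trans with (rpow (2 * Rabs (snd z)) rho); [apply rpow_le; lra|].
        rewrite rpow_mult by lra. apply Rmult_le_compat_l; lra.
      * apply Rle_trans with (rpow (2 * Rabs (fst z)) rho); [apply rpow_le; lra|].
        rewrite rpow_mult by lra. apply Rmult_le_compat_l; lra.
    + rewrite msum_scal, msum_plus.
      replace (4 * (9 / 2) ^ m * N) with (2 * (2 * M)) by (unfold M; ring).
      rewrite rpow_mult by lra. apply Rmult_le_compat_l; [apply rpow_ge0|].
      rewrite rpow_mult by lra.
      assert (2 <= rpow 2 rho).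
      { rewrite <- (rpow_1 2) at 1 by lra. rewrite !rpow_pos by lra. apply Rle_Rpower; lra. }
      assert (0 <= rpow M rho) by apply rpow_ge0. nra.
Qed.

(** * Comparison of mixed norms *)

(** If r < rho, Hölder's inequality against the constant 1 gives the power of n. Otherwise every f i
    is at most the l_rho norm B, so f^r <= B^(r-rho) f^rho. *)
Lemma lnorm_le n f r rho : (0 < n)%nat -> 0 < r -> 0 < rho -> (forall i, 0 <= f i) ->
  rpow (rsum n (fun i => rpow (f i) r)) (1 / r)
  <= Rpower (INR n) (if Rlt_dec r rho then 1 / r - 1 / rho else 0)
     * rpow (rsum n (fun i => rpow (f i) rho)) (1 / rho).
Proof.
  intros Hn Hr Hrho Hf.
  assert (HN : 0 < INR n) by (apply lt_0_INR; auto).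
  set (A := rsum n (fun i => rpow (f i) rho)).
  assert (HA : 0 <= A) by (apply rsum_nonneg; intros; apply rpow_ge0).
  assert (0 < 1 / r) by (apply Rdiv_lt_0_compat; lra).
  destruct Rlt_dec.
  - set (th := r / rho).
    assert (Hth : 0 <= th <= 1).
    { unfold th. split; [apply Rle_mult_inv_pos; lra|].
      apply (Rmult_le_reg_r rho); auto. unfold Rdiv. rewrite Rmult_assoc, Rinv_l; lra. }
    assert (H1 : rsum n (fun i => rpow (f i) r) <= rpow A th * rpow (INR n) (1 - th)).
    { pose proof (rsum_holder n (fun i => rpow (f i) rho) (fun _ => 1) th Hth
        ltac:(intros; apply rpow_ge0) ltac:(intros; lra)) as H1.
      rewrite rsum_const, Rmult_1_r in H1. fold A in H1.
      eapply Rle_trans; [|exact H1]. right. apply rsum_ext. intros i Hi. cbv beta.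
      rewrite rpow_one, Rmult_1_r, rpow_rpow. f_equal. unfold th. field. lra. }
    eapply Rle_trans; [apply rpow_le; [lra|exact H1]|].
    rewrite rpow_mult by apply rpow_ge0. rewrite !rpow_rpow. rewrite Rmult_comm.
    right. f_equal.
    + rewrite rpow_pos by auto. f_equal. unfold th. field. lra.
    + f_equal. unfold th. field. lra.
  - rewrite Rpower_O, Rmult_1_l by auto.
    set (B := rpow A (1 / rho)).
    assert (HB : 0 <= B) by apply rpow_ge0.
    assert (EB : rpow B rho = A) by (apply rpow_inv_cancel'; lra).
    assert (HfB : forall i, (i < n)%nat -> f i <= B).
    { intros i Hi. rewrite <- (rpow_inv_cancel (f i) rho) by (auto; lra).
      apply rpow_le; [apply Rle_mult_inv_pos; lra|].
      apply (rsum_term_le n (fun i => rpow (f i) rho)); auto. intros; apply rpow_ge0. }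
    rewrite <- (rpow_inv_cancel B r) by lra. apply rpow_le; [lra|].
    assert (Er : forall x, rpow x r = rpow x rho * rpow x (r - rho)).
    { intros x. rewrite <- rpow_plus. f_equal. ring. }
    rewrite (Er B), EB. unfold A. rewrite Rmult_comm, <- rsum_scal. apply rsum_le. intros i Hi.
    rewrite Er, Rmult_comm.
    apply Rmult_le_compat_r; [apply rpow_ge0|]. apply rpow_le; [lra|auto].
Qed.

Lemma lnorm_scal n c f r : 0 <= c -> 0 < r -> (forall i, 0 <= f i) ->
  rpow (rsum n (fun i => rpow (c * f i) r)) (1 / r)
  = c * rpow (rsum n (fun i => rpow (f i) r)) (1 / r).
Proof.
  intros Hc Hr Hf.
  rewrite (rsum_ext n _ (fun i => rpow c r * rpow (f i) r)) by (intros; apply rpow_mult; auto).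
  rewrite rsum_scal, rpow_mult.
  - rewrite rpow_inv_cancel; auto; lra.
  - apply rpow_ge0.
  - apply rsum_nonneg; intros; apply rpow_ge0.
Qed.

Lemma lnorm_mono n f g r : 0 < r -> (forall i, (i < n)%nat -> f i <= g i) ->
  rpow (rsum n (fun i => rpow (f i) r)) (1 / r) <= rpow (rsum n (fun i => rpow (g i) r)) (1 / r).
Proof.
  intros Hr H. apply rpow_le; [apply Rle_mult_inv_pos; lra|].
  apply rsum_le. intros. apply rpow_le; [lra|auto].
Qed.

Lemma mixn_ge0 n r d : forall l F idx, (forall i, 0 <= F i) -> 0 <= mixn n r l d F idx.
Proof. destruct d; intros; simpl; auto. apply rpow_ge0. Qed.

Lemma mixn_const n rho d : 0 < rho -> forall l F idx, (forall i, 0 <= F i) ->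
  mixn n (fun _ => rho) l d F idx = rpow (msum n l d (fun i => rpow (F i) rho) idx) (1 / rho).
Proof.
  intros Hr. induction d; intros l F idx HF; simpl.
  - rewrite rpow_inv_cancel; auto; lra.
  - f_equal. apply rsum_ext. intros i Hi. rewrite IHd by auto. apply rpow_inv_cancel'; [|lra].
    apply msum_nonneg. intros; apply rpow_ge0.
Qed.

Lemma mixn_le n r rho d : (0 < n)%nat -> 0 < rho -> forall l F idx,
  (forall j, (l <= j < l + d)%nat -> 0 < r j) -> (forall i, 0 <= F i) ->
  mixn n r l d F idx <=
  Rpower (INR n) (rsumr l d (fun j => if Rlt_dec (r j) rho then 1 / r j - 1 / rho else 0))
  * mixn n (fun _ => rho) l d F idx.
Proof.
  intros Hn Hrho. assert (HN : 0 < INR n) by (apply lt_0_INR; auto).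
  induction d; intros l F idx Hr HF.
  - simpl. rewrite Rpower_O by auto. lra.
  - cbn [mixn rsumr].
    set (c := Rpower (INR n) (rsumr (S l) d (fun j => if Rlt_dec (r j) rho then 1 / r j - 1 / rho else 0))).
    assert (Hc : 0 < c) by apply exp_pos.
    assert (Hrl : 0 < r l) by (apply Hr; lia).
    eapply Rle_trans.
    { apply lnorm_mono; auto. intros i Hi. apply IHd; auto. intros; apply Hr; lia. }
    fold c. rewrite (lnorm_scal n c (fun i => mixn n (fun _ => rho) (S l) d F (updv idx l i)));
      [|lra|auto|intros; apply mixn_ge0; auto].
    rewrite Rpower_plus. fold c.
    eapply Rle_trans.
    { apply Rmult_le_compat_l; [lra|]. apply (lnorm_le n (fun i => mixn n (fun _ => rho) (S l) d F (updv idx l i)) (r l) rho); auto. intros; apply mixn_ge0; auto. }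
    right. ring.
Qed.

Lemma s_exp_eq m p r : (0 < m)%nat -> invp_sum m p <= 1 / 2 -> s_exp m p r =
  rsumr 0 m (fun j => if Rlt_dec (r j) (rhoHL m p) then 1 / r j - 1 / rhoHL m p else 0).
Proof.
  intros Hm Hs. assert (1 <= INR m) by (apply (le_INR 1); lia).
  rewrite rsumr_rsum. unfold s_exp, cardM.
  rewrite <- rsum_scal. unfold Rminus at 1.
  rewrite <- (Rmult_1_l (rsum m (fun j => (INR m + _ - _) / _ * _))), Ropp_mult_distr_l, <- rsum_scal, <- rsum_plus.
  apply rsum_ext. intros j Hj. destruct Rlt_dec; [|ring].
  assert (E : 1 / rhoHL m p = (INR m + 1 - 2 * invp_sum m p) / (2 * INR m))
    by (unfold rhoHL; field; split; lra).
  rewrite E. ring.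
Qed.

Lemma opnorm_ge0 k m n p T N : is_opnorm k m n p T N ->
  (exists X, forall j, (j < m)%nat -> lpnorm k n (p j) (X j) <= 1) -> 0 <= N.
Proof.
  intros [H _] [X HX]. eapply Rle_trans; [apply (sabs_ge0 k (T X))|]. apply H. eauto.
Qed.

Lemma lpnorm_szero k n p : ge2 p -> lpnorm k n p (fun _ => szero k) <= 1.
Proof.
  intros Hp.
  assert (E : sabs k (szero k) = 0).
  { destruct k; simpl; [apply Rabs_R0|]. unfold Cmod. simpl. rewrite !Rmult_0_l, Rplus_0_r. apply sqrt_0. }
  destruct p as [q|]; cbn [lpnorm].
  - simpl in Hp. rewrite (rsum_ext n _ (fun _ => 0)).
    + rewrite rsum_zero, rpow_zero; lra.
    + intros. rewrite E. apply rpow_zero; lra.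
  - apply supnorm_le; [lra|]. intros; rewrite E; lra.
Qed.

Lemma mixed_upper_bound k m p : (2 <= m)%nat -> (forall j, (j < m)%nat -> ge2 (p j)) ->
  invp_sum m p <= 1 / 2 ->
  forall (r : nat -> R), (forall j, (j < m)%nat -> 0 < r j) ->
  forall (n : nat), (0 < n)%nat ->
  forall (T : (nat -> nat -> scal k) -> scal k) (N : R),
    multilinear k m n T -> is_opnorm k m n p T N ->
    mixed_sum k m n r T <= 4 * (9 / 2) ^ m * Rpower (INR n) (s_exp m p r) * N.
Proof.
  intros Hm Hp Hs r Hr n Hn T N HT HN.
  assert (N0 : 0 <= N).
  { eapply opnorm_ge0; eauto. exists (fun _ _ => szero k). intros; apply lpnorm_szero; auto. }
  assert (Hrho : 1 <= rhoHL m p) by (apply rhoHL_ge1; auto; lia).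
  set (K := 4 * (9 / 2) ^ m * Rpower (INR n) (s_exp m p r)).
  assert (HK : 0 < K).
  { apply Rmult_lt_0_compat; [|apply exp_pos]. apply Rmult_lt_0_compat; [lra|]. apply pow_lt; lra. }
  (* The norm may be 0, whereas the normalisation divides by it; hence the bound for every larger N'
     and a limit. *)
  assert (H : forall N', N < N' -> mixed_sum k m n r T <= K * N').
  { intros N' HN'. unfold mixed_sum.
    set (F := fun idx => sabs k (T (Eb k idx))).
    assert (HF : forall i, 0 <= F i) by (intros; apply sabs_ge0).
    eapply Rle_trans; [apply (mixn_le n r (rhoHL m p)); auto; try lra; intros; apply Hr; lia|].
    rewrite <- s_exp_eq by (auto; lia). rewrite mixn_const by (auto; lra).
    unfold K. rewrite (Rmult_comm (4 * _)), Rmult_assoc.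
    apply Rmult_le_compat_l; [left; apply exp_pos|].
    assert (HM : 0 <= 4 * (9 / 2) ^ m * N').
    { apply Rmult_le_pos; [|lra]. apply Rmult_le_pos; [lra|]. apply pow_le; lra. }
    rewrite <- (rpow_inv_cancel (4 * (9 / 2) ^ m * N') (rhoHL m p)) by lra.
    apply rpow_le; [apply Rle_mult_inv_pos; lra|].
    apply hardy_littlewood; auto; try lia; try lra.
    intros X HX. apply Rle_trans with N; [|lra]. apply HN. eauto. }
  apply le_epsilon. intros eps He.
  replace (K * N + eps) with (K * (N + eps / K)) by (field; lra).
  apply H. assert (0 < eps / K) by (apply Rdiv_lt_0_compat; auto). lra.
Qed.

(** * Multilinear forms with prescribed coefficients *)

Definition rk (k : field_kind) : R -> scal k :=
  match k return R -> scal k with KR => fun x => x | KC => fun x => (x, 0) end.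

Fixpoint ksum (k : field_kind) (n : nat) (f : nat -> scal k) : scal k :=
  match n with O => szero k | S n' => sadd k (ksum k n' f) (f n') end.

(** The form with coefficients c. They are real for both fields, so that the form maps real vectors
    to real values and estimates over R can be transferred. *)
Fixpoint tform (k : field_kind) (n l d : nat) (c : (nat -> nat) -> R)
  (X : nat -> nat -> scal k) (idx : nat -> nat) : scal k :=
  match d with
  | O => rk k (c idx)
  | S d' => ksum k n (fun i => smul k (X l i) (tform k n (S l) d' c X (updv idx l i)))
  end.

Ltac scal_ring :=
  match goal with k : field_kind |- _ => destruct k end; simpl in *;
  unfold Cadd, Cmul; simpl; repeat match goal with x : (R * R)%type |- _ => destruct x end; simpl;
  try ring; try (f_equal; ring).

Lemma smul_lin_l k (u v c A : scal k) :
  smul k (sadd k u (smul k c v)) A = sadd k (smul k u A) (smul k c (smul k v A)).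
Proof. scal_ring. Qed.

Lemma smul_lin_r k (x c A B : scal k) :
  smul k x (sadd k A (smul k c B)) = sadd k (smul k x A) (smul k c (smul k x B)).
Proof. scal_ring. Qed.

Lemma sadd_lin k (c F G f g : scal k) :
  sadd k (sadd k F (smul k c G)) (sadd k f (smul k c g)) = sadd k (sadd k F f) (smul k c (sadd k G g)).
Proof. scal_ring. Qed.

Lemma sadd_lin_0 k (c : scal k) : szero k = sadd k (szero k) (smul k c (szero k)).
Proof. scal_ring. Qed.

Lemma sadd_0_l k (x : scal k) : sadd k (szero k) x = x.
Proof. scal_ring. Qed.

Lemma sadd_0_r k (x : scal k) : sadd k x (szero k) = x.
Proof. scal_ring. Qed.

Lemma smul_1_l k (x : scal k) : smul k (sone k) x = x.
Proof. scal_ring. Qed.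

Lemma smul_0_l k (x : scal k) : smul k (szero k) x = szero k.
Proof. scal_ring. Qed.

Lemma rk_add k x y : rk k (x + y) = sadd k (rk k x) (rk k y).
Proof. scal_ring. Qed.

Lemma rk_mul k x y : rk k (x * y) = smul k (rk k x) (rk k y).
Proof. scal_ring. Qed.

Lemma rk_0 k : rk k 0 = szero k.
Proof. destruct k; reflexivity. Qed.

Lemma sabs_rk k x : sabs k (rk k x) = Rabs x.
Proof.
  destruct k; simpl; auto. unfold Cmod. simpl. rewrite Rmult_0_l, Rplus_0_r. apply sqrt_Rsqr_abs.
Qed.

Lemma sabs_mul k x y : sabs k (smul k x y) = sabs k x * sabs k y.
Proof.
  destruct k; simpl; [apply Rabs_mult|]. unfold Cmod, Cmul. destruct x as [a b], y as [c d]. simpl.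
  rewrite <- sqrt_mult.
  - f_equal. ring.
  - apply Rplus_le_le_0_compat; apply Rle_0_sqr.
  - apply Rplus_le_le_0_compat; apply Rle_0_sqr.
Qed.

Lemma sabs_add k x y : sabs k (sadd k x y) <= sabs k x + sabs k y.
Proof.
  destruct k; simpl; [apply Rabs_triang|]. unfold Cmod, Cadd. destruct x as [a b], y as [c d]. simpl.
  assert (P1 : 0 <= a * a + b * b) by (apply Rplus_le_le_0_compat; apply Rle_0_sqr).
  assert (P2 : 0 <= c * c + d * d) by (apply Rplus_le_le_0_compat; apply Rle_0_sqr).
  set (u := sqrt (a * a + b * b)). set (v := sqrt (c * c + d * d)).
  assert (Hu : 0 <= u) by apply sqrt_pos. assert (Hv : 0 <= v) by apply sqrt_pos.
  assert (Eu : u * u = a * a + b * b) by (apply sqrt_sqrt; auto).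
  assert (Ev : v * v = c * c + d * d) by (apply sqrt_sqrt; auto).
  assert (a * c + b * d <= u * v).
  { apply Rle_trans with (sqrt ((a * c + b * d) * (a * c + b * d))).
    - fold (Rsqr (a * c + b * d)). rewrite sqrt_Rsqr_abs. apply Rle_abs.
    - rewrite <- (sqrt_square (u * v)) by (apply Rmult_le_pos; auto).
      apply sqrt_le_1_alt. replace (u * v * (u * v)) with (u * u * (v * v)) by ring.
      rewrite Eu, Ev. assert (H := Rle_0_sqr (a * d - b * c)). unfold Rsqr in H. lra. }
  rewrite <- (sqrt_square (u + v)) by lra. apply sqrt_le_1_alt. lra.
Qed.

Lemma ksum_ext k n f g : (forall i, (i < n)%nat -> f i = g i) -> ksum k n f = ksum k n g.
Proof. induction n; intros H; simpl; auto. rewrite IHn, H; auto. Qed.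

Lemma ksum_lin k n c f g :
  ksum k n (fun i => sadd k (f i) (smul k c (g i))) = sadd k (ksum k n f) (smul k c (ksum k n g)).
Proof. induction n; simpl; [apply sadd_lin_0|]. rewrite IHn. apply sadd_lin. Qed.

Lemma ksum_ebasis k n a f : (a < n)%nat -> ksum k n (fun i => smul k (ebasis k a i) (f i)) = f a.
Proof.
  assert (Z : forall N, (N <= a)%nat -> ksum k N (fun i => smul k (ebasis k a i) (f i)) = szero k).
  { induction N; intros H; simpl; auto. rewrite IHN by lia. unfold ebasis.
    destruct (Nat.eqb_spec N a); [lia|]. rewrite smul_0_l. apply sadd_0_r. }
  induction n; intros H; [lia|]. simpl. unfold ebasis at 2. destruct (Nat.eqb_spec n a) as [->|Hn].
  - rewrite Z by lia. rewrite smul_1_l. apply sadd_0_l.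
  - rewrite IHn by lia. rewrite smul_0_l. apply sadd_0_r.
Qed.

Lemma ksum_sabs k n f : sabs k (ksum k n f) <= rsum n (fun i => sabs k (f i)).
Proof.
  induction n; simpl.
  - rewrite <- rk_0, sabs_rk, Rabs_R0. lra.
  - eapply Rle_trans; [apply sabs_add|]. lra.
Qed.

Lemma tform_ext k n c X Y d : forall l idx,
  (forall j i, (l <= j < l + d)%nat -> (i < n)%nat -> X j i = Y j i) ->
  tform k n l d c X idx = tform k n l d c Y idx.
Proof.
  induction d; intros l idx H; simpl; auto. apply ksum_ext. intros i Hi.
  rewrite H by lia. f_equal. apply IHd. intros; apply H; lia.
Qed.

Lemma tform_lin k n c X j u v a d : forall l idx, (l <= j < l + d)%nat ->
  tform k n l d c (updv X j (fun i => sadd k (u i) (smul k a (v i)))) idx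
  = sadd k (tform k n l d c (updv X j u) idx) (smul k a (tform k n l d c (updv X j v) idx)).
Proof.
  induction d; intros l idx H; [lia|]. simpl. rewrite <- ksum_lin. apply ksum_ext. intros i Hi.
  destruct (Nat.eq_dec l j) as [->|Hl].
  - rewrite !updv_same.
    assert (E : forall w, tform k n (S j) d c (updv X j w) (updv idx j i) = tform k n (S j) d c X (updv idx j i)).
    { intros w. apply tform_ext. intros. rewrite updv_other by lia. reflexivity. }
    rewrite !E. apply smul_lin_l.
  - rewrite !(updv_other X j) by auto. rewrite IHd by lia. apply smul_lin_r.
Qed.

(** Allowing n' < n gives forms that see only the first coordinates; n' = 1 yields their product. *)
Lemma tform_multilinear k m n n' c idx : (n' <= n)%nat ->
  multilinear k m n (fun X => tform k n' 0 m c X idx).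
Proof.
  intros Hn. split.
  - intros X Y H. apply tform_ext. intros; apply H; lia.
  - intros j X u v a Hj. apply tform_lin. lia.
Qed.

(** Which coefficient appears is left open: in the applications all of them have modulus 1. *)
Lemma tform_ebasis k n c e d : forall l idx,
  (forall j, (l <= j < l + d)%nat -> (e j < n)%nat) ->
  exists i, tform k n l d c (Eb k e) idx = rk k (c i).
Proof.
  induction d; intros l idx H; simpl; [eauto|].
  rewrite ksum_ebasis by (apply H; lia). apply IHd. intros; apply H; lia.
Qed.

Lemma tform_bound k n c X d : (forall i, Rabs (c i) <= 1) -> forall l idx,
  (forall j i, (l <= j < l + d)%nat -> (i < n)%nat -> sabs k (X j i) <= 1) ->
  sabs k (tform k n l d c X idx) <= INR n ^ d.
Proof.
  intros Hc. induction d; intros l idx H; simpl.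
  - rewrite sabs_rk. apply Hc.
  - eapply Rle_trans; [apply ksum_sabs|]. rewrite <- rsum_const. apply rsum_le. intros i Hi.
    rewrite sabs_mul. rewrite <- (Rmult_1_l (INR n ^ d)).
    apply Rmult_le_compat; try apply sabs_ge0; [apply H; lia|].
    apply IHd. intros; apply H; lia.
Qed.

Lemma tform_rk k n c (X : nat -> nat -> R) d : forall l idx,
  tform k n l d c (fun j i => rk k (X j i)) idx = rk k (tform KR n l d c X idx).
Proof.
  induction d; intros l idx; simpl; auto.
  assert (E : forall N f, rk k (ksum KR N f) = ksum k N (fun i => rk k (f i))).
  { induction N; intros; simpl; [apply rk_0|]. rewrite rk_add, IHN. reflexivity. }
  rewrite E. apply ksum_ext. intros i Hi. rewrite IHd, rk_mul. reflexivity.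
Qed.

Lemma ksum_KR n f : ksum KR n f = rsum n f.
Proof. induction n; simpl; auto. rewrite IHn. reflexivity. Qed.

Lemma tform_msum n c (X : nat -> nat -> R) d : forall l idx,
  tform KR n l d c X idx = msum n l d (fun i => c i * rprodr l d (fun j => X j (i j))) idx.
Proof.
  induction d; intros l idx; simpl; [ring|]. rewrite ksum_KR. apply rsum_ext. intros i Hi.
  rewrite IHd, <- msum_scal. apply msum_ext. intros idx' Hb.
  apply in_box_step in Hb; auto. destruct Hb as [_ ->]. ring.
Qed.

(** Telescoping over the slots through xA - yB = (x - y)A + y(A - B), each slot costing at most n^d
    e. *)
Lemma tform_perturb n c (X Y : nat -> nat -> R) e d : (forall i, Rabs (c i) <= 1) -> 0 <= e -> forall l idx,
  (forall j i, (l <= j < l + d)%nat -> (i < n)%nat ->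
     Rabs (X j i) <= 1 /\ Rabs (Y j i) <= 1 /\ Rabs (X j i - Y j i) <= e) ->
  Rabs (tform KR n l d c X idx - tform KR n l d c Y idx) <= INR d * INR n ^ d * e.
Proof.
  intros Hc He. assert (Hn : 0 <= INR n) by apply pos_INR.
  induction d; intros l idx H.
  - simpl. rewrite Rminus_diag, Rabs_R0. lra.
  - cbn [tform]. rewrite !ksum_KR.
    match goal with |- Rabs (rsum n ?f - rsum n ?g) <= _ => set (F := f); set (G := g) end.
    assert (E : rsum n F - rsum n G = rsum n (fun i => F i + -1 * G i))
      by (rewrite rsum_plus, rsum_scal; ring).
    rewrite E. eapply Rle_trans; [apply rsum_Rabs|].
    assert (Pn : 0 <= INR n ^ d) by (apply pow_le; auto).
    apply Rle_trans with (rsum n (fun _ => (1 + INR d) * INR n ^ d * e)).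
    + apply rsum_le. intros i Hi. unfold F, G. simpl smul.
      destruct (H l i ltac:(lia) Hi) as [H1 [H2 H3]].
      assert (H4 : Rabs (tform KR n (S l) d c X (updv idx l i) - tform KR n (S l) d c Y (updv idx l i))
         <= INR d * INR n ^ d * e) by (apply IHd; intros; apply H; lia).
      assert (H5 : Rabs (tform KR n (S l) d c X (updv idx l i)) <= INR n ^ d)
        by (apply (tform_bound KR); auto; intros; apply H; lia).
      set (A := tform KR n (S l) d c X (updv idx l i)) in *.
      set (B := tform KR n (S l) d c Y (updv idx l i)) in *.
      replace (X l i * A + -1 * (Y l i * B)) with ((X l i - Y l i) * A + Y l i * (A - B)) by ring.
      eapply Rle_trans; [apply Rabs_triang|]. rewrite !Rabs_mult.
      assert (Rabs (X l i - Y l i) * Rabs A <= e * INR n ^ d)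
        by (apply Rmult_le_compat; auto; apply Rabs_pos).
      assert (Rabs (Y l i) * Rabs (A - B) <= 1 * (INR d * INR n ^ d * e))
        by (apply Rmult_le_compat; auto; apply Rabs_pos).
      lra.
    + rewrite rsum_const, S_INR. simpl pow. right; ring.
Qed.

(** * Random signs *)

(** The subgaussian bound for a random sign. For |y| > 1/2 it is immediate from |y| <= 2 y^2. *)
Lemma cosh_le y : (exp y + exp (- y)) / 2 <= exp (2 * (y * y)).
Proof.
  assert (Hy2 : 0 <= y * y) by apply Rle_0_sqr.
  destruct (Rle_dec (Rabs y) (1 / 2)) as [H|H].
  - assert (-(1/2) <= y <= 1/2).
    { assert (y <= Rabs y) by apply Rle_abs. assert (- y <= Rabs y) by (rewrite <- Rabs_Ropp; apply Rle_abs). lra. }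
    (* From exp(-z) >= 1 - z, because (1 + z + 2z^2)(1 - z) = 1 + z^2 (1 - 2z) is at least 1 here.
       The linear terms cancel between y and -y. *)
    assert (Q : forall z, - (1/2) <= z <= 1/2 -> exp z <= 1 + z + 2 * (z * z)).
    { intros z Hz. assert (E := exp_ineq1_le (- z)). rewrite exp_Ropp in E.
      assert (P := exp_pos z).
      apply (Rmult_le_compat_l (exp z)) in E; [|lra]. rewrite Rinv_r in E by lra.
      apply (Rmult_le_reg_r (1 - z)); [lra|].
      assert (0 <= z * z * (1 - 2 * z)) by (apply Rmult_le_pos; [apply Rle_0_sqr|lra]).
      lra. }
    assert (Q1 := Q y ltac:(lra)). assert (Q2 := Q (- y) ltac:(lra)).
    assert (E := exp_ineq1_le (2 * (y * y))). lra.
  - assert (Hle : Rabs y <= 2 * (y * y)).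
    { assert (E := Rsqr_abs y). unfold Rsqr in E. rewrite E. nra. }
    assert (H1 : exp y <= exp (2 * (y * y))).
    { assert (y <= Rabs y) by apply Rle_abs. destruct (Req_dec y (2 * (y * y))) as [<-|]; [lra|].
      left. apply exp_increasing. lra. }
    assert (H2 : exp (- y) <= exp (2 * (y * y))).
    { assert (- y <= Rabs y) by (rewrite <- Rabs_Ropp; apply Rle_abs).
      destruct (Req_dec (- y) (2 * (y * y))) as [<-|]; [lra|].
      left. apply exp_increasing. lra. }
    lra.
Qed.

(* The signs are chosen one after another; the weights record the earlier choices. *)
Lemma exists_signs N n d : forall l idx (w : nat -> R) (f : nat -> (nat -> nat) -> R),
  (forall x, 0 <= w x) ->
  exists c : (nat -> nat) -> R, (forall i, is_sign (c i)) /\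
  rsum N (fun x => w x * exp (msum n l d (fun i => c i * f x i) idx))
  <= rsum N (fun x => w x * exp (2 * msum n l d (fun i => f x i * f x i) idx)).
Proof.
  induction d; intros l idx w f Hw.
  - simpl.
    set (A := rsum N (fun x => w x * exp (1 * f x idx))).
    set (B := rsum N (fun x => w x * exp (-1 * f x idx))).
    assert (H : (A + B) / 2 <= rsum N (fun x => w x * exp (2 * (f x idx * f x idx)))).
    { replace ((A + B) / 2) with (/ 2 * (A + B)) by (unfold Rdiv; ring).
      unfold A, B. rewrite <- rsum_plus, <- rsum_scal. apply rsum_le. intros x Hx.
      replace (/ 2 * (w x * exp (1 * f x idx) + w x * exp (-1 * f x idx)))
        with (w x * ((exp (f x idx) + exp (- f x idx)) / 2)).
      - apply Rmult_le_compat_l; auto. apply cosh_le.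
      - rewrite Rmult_1_l. replace (-1 * f x idx) with (- f x idx) by ring. field. }
    destruct (Rle_dec A B).
    + exists (fun _ => 1). split; [intros; left; auto|]. fold A. lra.
    + exists (fun _ => -1). split; [intros; right; auto|]. fold B. lra.
  - cbn [msum].
    assert (H : forall n', (n' <= n)%nat -> forall w, (forall x, 0 <= w x) ->
      exists c : (nat -> nat) -> R, (forall i, is_sign (c i)) /\
      rsum N (fun x => w x * exp (rsum n' (fun a => msum n (S l) d (fun i => c i * f x i) (updv idx l a))))
      <= rsum N (fun x => w x * exp (2 * rsum n' (fun a => msum n (S l) d (fun i => f x i * f x i) (updv idx l a))))).
    { clear w Hw. induction n'; intros Hn' w Hw; cbn [rsum].
      - exists (fun _ => 1). split; [intros; left; auto|]. rewrite Rmult_0_r. lra.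
      - set (B2 := fun x => msum n (S l) d (fun i => f x i * f x i) (updv idx l n')).
        (* The signs of the first n' blocks are chosen with block n' already charged its bound exp(2
           [B2]); the signs of block n' are then chosen with the actual values exp([A]) as weights.
           Blocks differ in the index at slot l, so the choices do not interfere. *)
        destruct (IHn' ltac:(lia) (fun x => w x * exp (2 * B2 x))) as [c [Hc1 Hc2]].
        { intros; apply Rmult_le_pos; auto; left; apply exp_pos. }
        set (A := fun x => rsum n' (fun a => msum n (S l) d (fun i => c i * f x i) (updv idx l a))) in *.
        destruct (IHd (S l) (updv idx l n') (fun x => w x * exp (A x)) f) as [c1 [Hd1 Hd2]].
        { intros; apply Rmult_le_pos; auto; left; apply exp_pos. }
        exists (fun i => if Nat.eqb (i l) n' then c1 i else c i). split.
        + intros i. destruct Nat.eqb; auto.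
        + eapply Rle_trans; [|eapply Rle_trans; [exact Hd2|eapply Rle_trans; [|eapply Rle_trans; [exact Hc2|]]]]; right; apply rsum_ext; intros x Hx.
          * rewrite exp_plus, <- Rmult_assoc. f_equal; [f_equal|]; f_equal.
            -- unfold A. apply rsum_ext. intros a Ha. apply msum_ext. intros i Hb.
               apply in_box_step in Hb; [|lia]. destruct Hb as [_ ->].
               destruct (Nat.eqb_spec a n'); [lia|auto].
            -- apply msum_ext. intros i Hb. apply in_box_step in Hb; [|lia]. destruct Hb as [_ ->].
               rewrite Nat.eqb_refl. reflexivity.
          * fold (B2 x). fold (A x). ring.
          * rewrite Rmult_plus_distr_l, exp_plus. fold (B2 x). ring. }
    apply (H n (le_n n) w Hw).
Qed.

(** * A net in the Euclidean ball *)

(** Base-B digits encode a net point as one natural number, making the net a range of summation for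
    [rsum]. *)
Definition dig (B t x : nat) : nat := ((x / B ^ t) mod B)%nat.

Lemma dig_surj B K (g : nat -> nat) : (0 < B)%nat -> (forall t, (t < K)%nat -> (g t < B)%nat) ->
  exists x, (x < B ^ K)%nat /\ forall t, (t < K)%nat -> dig B t x = g t.
Proof.
  intros HB. induction K; intros H.
  - exists O. split; [simpl; lia|intros; lia].
  - destruct IHK as [x [Hx1 Hx2]]; [intros; apply H; lia|].
    assert (HgK : (g K < B)%nat) by (apply H; lia).
    exists (x + g K * B ^ K)%nat. split; [simpl; nia|].
    intros t Ht. unfold dig. assert (HBt : (B ^ t <> 0)%nat) by (apply Nat.pow_nonzero; lia).
    destruct (Nat.eq_dec t K) as [->|].
    + rewrite Nat.div_add by auto. rewrite Nat.div_small by auto. rewrite Nat.add_0_l. apply Nat.mod_small; auto.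
    + assert (E : (B ^ K = B ^ (K - S t) * B * B ^ t)%nat).
      { replace K with (K - S t + 1 + t)%nat at 1 by lia. rewrite !Nat.pow_add_r, Nat.pow_1_r. reflexivity. }
      rewrite E. rewrite !Nat.mul_assoc. rewrite Nat.div_add by auto.
      rewrite <- (Hx2 t) by lia. unfold dig. rewrite Nat.Div0.mod_add. reflexivity.
Qed.

Lemma nat_floor M z : 0 <= z <= INR M -> exists a, (a <= M)%nat /\ INR a <= z <= INR a + 1.
Proof.
  induction M; intros H.
  - exists O. simpl in *. split; [lia|lra].
  - destruct (Rle_dec z (INR M)) as [Hz|Hz].
    + destruct IHM as [a [H1 H2]]; [lra|]. exists a. split; [lia|auto].
    + exists M. rewrite S_INR in H. split; [lia|lra].
Qed.

Definition grid (M g : nat) : R := (INR g - INR M) / INR M.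

(** Rounding is towards 0: moduli do not grow, so a vector of the Euclidean ball is approximated
    within the ball. *)
Lemma grid_round M x : (0 < M)%nat -> Rabs x <= 1 -> exists g, (g < 2 * M + 1)%nat /\
  Rabs (grid M g) <= Rabs x /\ Rabs (x - grid M g) <= / INR M.
Proof.
  intros HM Hx. assert (HMp : 0 < INR M) by (apply lt_0_INR; auto).
  assert (Hi : 0 < / INR M) by (apply Rinv_0_lt_compat; auto).
  assert (Hx0 := Rabs_pos x).
  destruct (nat_floor M (INR M * Rabs x)) as [a [Ha1 Ha2]]; [split; nra|].
  assert (B1 : INR a / INR M <= Rabs x).
  { apply (Rmult_le_reg_l (INR M)); auto. replace (INR M * (INR a / INR M)) with (INR a) by (field; lra). lra. }
  assert (B2 : Rabs x <= INR a / INR M + / INR M).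
  { apply (Rmult_le_reg_l (INR M)); auto.
    replace (INR M * (INR a / INR M + / INR M)) with (INR a + 1) by (field; lra). lra. }
  assert (B3 : 0 <= INR a / INR M) by (apply Rle_mult_inv_pos; auto; apply pos_INR).
  destruct (Rle_dec 0 x) as [H0|H0].
  - exists (M + a)%nat. split; [lia|].
    assert (E : grid M (M + a) = INR a / INR M) by (unfold grid; rewrite plus_INR; field; lra).
    rewrite E. rewrite (Rabs_pos_eq x) in * by lra. rewrite (Rabs_pos_eq (INR a / INR M)) by auto.
    split; auto. rewrite Rabs_pos_eq; lra.
  - exists (M - a)%nat. split; [lia|].
    assert (E : grid M (M - a) = - (INR a / INR M)) by (unfold grid; rewrite minus_INR by lia; field; lra).
    rewrite E. rewrite (Rabs_left x) in * by lra. rewrite Rabs_Ropp, (Rabs_pos_eq (INR a / INR M)) by auto.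
    split; auto. rewrite Rabs_left1; lra.
Qed.

Definition net (n M x : nat) (l i : nat) : R := grid M (dig (2 * M + 1) (l * n + i) x).

Lemma net_approx m n M (X : nat -> nat -> R) : (0 < n)%nat -> (0 < M)%nat ->
  (forall l i, (l < m)%nat -> (i < n)%nat -> Rabs (X l i) <= 1) ->
  exists x, (x < (2 * M + 1) ^ (m * n))%nat /\
   forall l i, (l < m)%nat -> (i < n)%nat ->
     Rabs (net n M x l i) <= Rabs (X l i) /\ Rabs (X l i - net n M x l i) <= / INR M.
Proof.
  intros Hn HM HX.
  (* The roundings of all m n entries are collected into one function by induction; entry (l, i) has
     position l n + i. *)
  assert (H : forall K, (K <= m * n)%nat -> exists g : nat -> nat, forall t, (t < K)%nat ->
     (g t < 2 * M + 1)%nat /\ Rabs (grid M (g t)) <= Rabs (X (t / n)%nat (t mod n)%nat) /\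
     Rabs (X (t / n)%nat (t mod n)%nat - grid M (g t)) <= / INR M).
  { induction K; intros HK; [exists (fun _ => O); intros; lia|].
    destruct IHK as [g Hg]; [lia|].
    destruct (grid_round M (X (K / n)%nat (K mod n)%nat)) as [a Ha]; auto.
    { apply HX; [apply Nat.Div0.div_lt_upper_bound; lia|apply Nat.mod_upper_bound; lia]. }
    exists (fun t => if Nat.eqb t K then a else g t). intros t Ht.
    destruct (Nat.eqb_spec t K) as [->|]; auto. apply Hg; lia. }
  destruct (H (m * n)%nat (le_n _)) as [g Hg].
  destruct (dig_surj (2 * M + 1) (m * n) g ltac:(lia)) as [x [Hx1 Hx2]].
  { intros t Ht. apply Hg; auto. }
  exists x. split; auto. intros l i Hl Hi.
  assert (Ht : (l * n + i < m * n)%nat) by nia.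
  unfold net. rewrite Hx2 by auto. specialize (Hg _ Ht).
  assert (E1 : ((l * n + i) / n = l)%nat).
  { rewrite Nat.add_comm, Nat.div_add by lia. rewrite Nat.div_small; lia. }
  assert (E2 : ((l * n + i) mod n = i)%nat).
  { rewrite Nat.add_comm, Nat.Div0.mod_add. apply Nat.mod_small; auto. }
  rewrite E1, E2 in Hg. apply Hg.
Qed.

Lemma sq_le_of_Rabs x y : Rabs x <= Rabs y -> x * x <= y * y.
Proof. intros H. apply (Rsqr_le_abs_1 x y H). Qed.

Lemma ball_entry n x i : rsum n (fun i => x i * x i) <= 1 -> (i < n)%nat -> Rabs (x i) <= 1.
Proof.
  intros H Hi. assert (x i * x i <= 1).
  { eapply Rle_trans; [|exact H]. apply (rsum_term_le n (fun i => x i * x i)); auto.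
    intros; apply Rle_0_sqr. }
  rewrite <- sqrt_Rsqr_abs, <- sqrt_1. apply sqrt_le_1_alt. exact H0.
Qed.

(** A union bound over the net in exponential form. The N = B^(m n) points have ln N = m n ln B, and
    each exponential moment at parameter [lam] is at most exp(2 lam^2). With lam = sqrt n both
    contributions have order n up to ln B; dividing by lam gives the bound. *)
Lemma random_form_aux m n : (0 < n)%nat -> exists c : (nat -> nat) -> R, (forall i, is_sign (c i)) /\
  forall X : nat -> nat -> R, (forall l, (l < m)%nat -> rsum n (fun i => X l i * X l i) <= 1) ->
  tform KR n 0 m c X zidx <= sqrt (INR n) * (INR m * ln (2 * INR n ^ m + 1) + 2) + INR m.
Proof.
  intros Hn. assert (HN : 0 < INR n) by (apply lt_0_INR; auto).
  (* Mesh 1/n^m: the perturbation error m n^m / M is then just m. *)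
  set (M := (n ^ m)%nat). assert (HM : (0 < M)%nat) by (apply Nat.neq_0_lt_0, Nat.pow_nonzero; lia).
  set (B := (2 * M + 1)%nat). set (N := (B ^ (m * n))%nat).
  set (lam := sqrt (INR n)). assert (Hlam : 0 < lam) by (apply sqrt_lt_R0; auto).
  assert (El : lam * lam = INR n) by (apply sqrt_sqrt; lra).
  set (P := fun x idx => rprodr 0 m (fun j => net n M x j (idx j))).
  (* Net points whose tensor product has Euclidean norm above 1 are discarded; their exponential
     moments would not be controlled. *)
  set (w := fun x => if Rle_dec (tot n m (fun i => P x i * P x i)) 1 then 1 else 0).
  destruct (exists_signs N n m 0 zidx w (fun x i => lam * P x i)) as [c [Hc1 Hc2]].
  { intros x. unfold w. destruct Rle_dec; lra. }
  exists c. split; auto. intros X HX.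
  assert (HX1 : forall l i, (l < m)%nat -> (i < n)%nat -> Rabs (X l i) <= 1)
    by (intros; apply (ball_entry n); auto).
  destruct (net_approx m n M X Hn HM HX1) as [x [Hx1 Hx2]]. fold B in Hx1. fold N in Hx1.
  assert (Hw : w x = 1).
  { unfold w. destruct Rle_dec as [|Hf]; auto. exfalso. apply Hf.
    unfold P. rewrite (msum_ext _ _ _ _ (fun i => rprodr 0 m (fun j => net n M x j (i j) * net n M x j (i j))))
      by (intros; symmetry; apply rprodr_mult).
    rewrite (msum_prod n m 0 (fun j a => net n M x j a * net n M x j a)).
    apply rprodr_le_1. intros j Hj. split; [apply rsum_nonneg; intros; apply Rle_0_sqr|].
    eapply Rle_trans; [|apply (HX j); lia]. apply rsum_le. intros a Ha.
    apply sq_le_of_Rabs. apply Hx2; auto; lia. }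
  assert (Hup : rsum N (fun x => w x * exp (2 * tot n m (fun i => lam * P x i * (lam * P x i))))
     <= INR N * exp (2 * INR n)).
  { rewrite <- rsum_const. apply rsum_le. intros y _. unfold w. destruct Rle_dec as [Hy|].
    - rewrite Rmult_1_l. rewrite (msum_ext _ _ _ _ (fun i => INR n * (P y i * P y i)))
        by (intros; rewrite <- El; ring).
      rewrite msum_scal. set (t := tot n m (fun i => P y i * P y i)) in *.
      destruct (Req_dec t 1) as [->|]; [rewrite Rmult_1_r; lra|].
      left. apply exp_increasing. nra.
    - rewrite Rmult_0_l. left; apply exp_pos. }
  assert (Hlow : exp (lam * tform KR n 0 m c (net n M x) zidx) <= INR N * exp (2 * INR n)).
  { eapply Rle_trans; [|exact Hup]. eapply Rle_trans; [|exact Hc2].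
    pose proof (rsum_term_le N (fun x => w x * exp (tot n m (fun i => c i * (lam * P x i)))) x) as H.
    cbv beta in H. rewrite Hw, Rmult_1_l in H.
    rewrite tform_msum, <- msum_scal. rewrite (msum_ext _ _ _ _ (fun i => c i * (lam * P x i))).
    - apply H; auto. intros y _. apply Rmult_le_pos; [unfold w; destruct Rle_dec; lra|left; apply exp_pos].
    - intros i _. unfold P. ring. }
  assert (HB : 0 < INR B) by (apply lt_0_INR; unfold B; lia).
  assert (HNp : 0 < INR N) by (unfold N; rewrite pow_INR; apply pow_lt; auto).
  assert (EB : INR B = 2 * INR n ^ m + 1).
  { unfold B, M. rewrite plus_INR, mult_INR, pow_INR. simpl. ring. }
  assert (HlnN : ln (INR N) = INR m * INR n * ln (INR B)).
  { unfold N. rewrite pow_INR, ln_pow, mult_INR by auto. reflexivity. }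
  assert (Hlin : lam * tform KR n 0 m c (net n M x) zidx <= INR m * INR n * ln (INR B) + 2 * INR n).
  { rewrite <- HlnN. rewrite <- (ln_exp (lam * _)).
    rewrite <- (ln_exp (2 * INR n)) , <- ln_mult by (auto; apply exp_pos).
    destruct Hlow as [Hlow|Hlow]; [left; apply ln_increasing; auto; apply exp_pos|rewrite Hlow; lra]. }
  assert (Hnet : tform KR n 0 m c (net n M x) zidx <= lam * (INR m * ln (INR B) + 2)).
  { apply (Rmult_le_reg_l lam); auto. rewrite <- Rmult_assoc, El. lra. }
  rewrite <- EB.
  assert (Hd : Rabs (tform KR n 0 m c X zidx - tform KR n 0 m c (net n M x) zidx) <= INR m * INR n ^ m * / INR M).
  { apply tform_perturb.
    - intros i. destruct (Hc1 i) as [-> | ->]; [rewrite Rabs_R1; lra|rewrite Rabs_left; lra].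
    - left; apply Rinv_0_lt_compat, lt_0_INR; auto.
    - intros j i Hj Hi. destruct (Hx2 j i ltac:(lia) Hi) as [H1 H2].
      assert (Rabs (X j i) <= 1) by (apply HX1; auto; lia).
      repeat split; auto. lra. }
  replace (INR m * INR n ^ m * / INR M) with (INR m) in Hd.
  2:{ unfold M. rewrite pow_INR. field. apply pow_nonzero; lra. }
  match type of Hd with Rabs ?z <= _ => assert (z <= Rabs z) by apply Rle_abs end.
  lra.
Qed.

Lemma Rpower_ge1 x a : 1 <= x -> 0 <= a -> 1 <= Rpower x a.
Proof. intros Hx Ha. rewrite <- (Rpower_O x) by lra. apply Rle_Rpower; lra. Qed.

Lemma ln_le_Rpower x de : 1 <= x -> 0 < de -> ln x <= Rpower x de / de.
Proof.
  intros Hx Hd. assert (E := exp_ineq1_le (de * ln x)). fold (Rpower x de) in E.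
  apply (Rmult_le_reg_l de); auto.
  replace (de * (Rpower x de / de)) with (Rpower x de) by (field; lra). lra.
Qed.

Lemma random_form_real m de : (0 < m)%nat -> 0 < de -> exists K, 0 < K /\
  forall n, (0 < n)%nat -> exists c : (nat -> nat) -> R, (forall i, is_sign (c i)) /\
  forall X : nat -> nat -> R, (forall l, (l < m)%nat -> rsum n (fun i => X l i * X l i) <= 1) ->
  Rabs (tform KR n 0 m c X zidx) <= K * Rpower (INR n) (1 / 2 + de).
Proof.
  intros Hm Hd. assert (HM : 1 <= INR m) by (apply (le_INR 1); lia).
  (* From ln(2 n^m + 1) <= ln 3 + m ln n <= 2 + m n^de / de. *)
  exists (INR m * (2 + INR m / de) + 2 + INR m).
  assert (HK : 0 < INR m / de) by (apply Rdiv_lt_0_compat; lra).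
  split; [nra|]. intros n Hn.
  assert (HN : 1 <= INR n) by (apply (le_INR 1); lia).
  destruct (random_form_aux m n Hn) as [c [Hc1 Hc2]]. exists c. split; auto.
  set (nd := Rpower (INR n) de). assert (Hnd : 1 <= nd) by (apply Rpower_ge1; lra).
  assert (Hln : ln (2 * INR n ^ m + 1) <= (2 + INR m / de) * nd).
  { assert (P1 : 1 <= INR n ^ m) by (apply pow_R1_Rle; auto).
    apply Rle_trans with (ln (3 * INR n ^ m)).
    - destruct (Req_dec (2 * INR n ^ m + 1) (3 * INR n ^ m)) as [->|]; [lra|].
      left. apply ln_increasing; lra.
    - rewrite ln_mult, ln_pow by lra.
      assert (L3 : ln 3 <= 2).
      { assert (T3 := tangent_le 3 1 ltac:(lra) ltac:(lra)). rewrite ln_1 in T3. lra. }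
      assert (L4 := ln_le_Rpower (INR n) de HN Hd). fold nd in L4.
      apply (Rmult_le_compat_l (INR m)) in L4; [|lra].
      replace (INR m * (nd / de)) with (INR m / de * nd) in L4 by (field; lra). nra. }
  assert (Hsq : 1 <= sqrt (INR n)) by (rewrite <- sqrt_1; apply sqrt_le_1_alt; auto).
  assert (Hup : forall X : nat -> nat -> R, (forall l, (l < m)%nat -> rsum n (fun i => X l i * X l i) <= 1) ->
    tform KR n 0 m c X zidx <= (INR m * (2 + INR m / de) + 2 + INR m) * Rpower (INR n) (1 / 2 + de)).
  { intros X HX. eapply Rle_trans; [apply Hc2; auto|].
    rewrite Rpower_plus. fold nd. replace (1 / 2) with (/ 2) by lra. rewrite Rpower_sqrt by lra.
    set (sq := sqrt (INR n)) in *. set (L := ln (2 * INR n ^ m + 1)) in *.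
    assert (1 <= sq * nd) by nra.
    assert (sq <= sq * nd) by nra.
    apply (Rmult_le_compat_l (INR m)) in Hln; [|lra].
    apply (Rmult_le_compat_l sq) in Hln; [|lra].
    assert (INR m <= INR m * (sq * nd)) by nra. lra. }
  intros X HX. apply Rabs_le. split; [|apply Hup; auto].
  assert (HT := tform_multilinear KR m n n c zidx (le_n n)).
  (* The lower bound follows from the upper one by changing the sign of the vector in slot 0. *)
  pose proof (Hup (updv X 0 (fun l => -1 * X 0%nat l))) as H. lapply H; clear H.
  - intros H. rewrite (mlin_scal m n _ HT), updv_id in H by lia. cbv beta in H. lra.
  - intros l Hl. unfold updv. destruct (Nat.eqb_spec l 0) as [->|]; [|apply HX; auto].
    eapply Rle_trans; [|apply (HX 0%nat); auto]. right. apply rsum_ext. intros i Hi.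
    change (-1 * X 0%nat i * (-1 * X 0%nat i) = X 0%nat i * X 0%nat i). ring.
Qed.

(** * From real vectors to vectors over either field *)

Definition sre (k : field_kind) : scal k -> R :=
  match k return scal k -> R with KR => fun x => x | KC => fst end.
Definition sim (k : field_kind) : scal k -> R :=
  match k return scal k -> R with KR => fun _ => 0 | KC => snd end.
(** Over R the value 0 stands in for the imaginary unit, so that the splitting into two parts is
    uniform in the field. *)
Definition siota (k : field_kind) : scal k :=
  match k return scal k with KR => 0 | KC => (0, 1) end.

Lemma scal_split k x : x = sadd k (rk k (sre k x)) (smul k (siota k) (rk k (sim k x))).
Proof.
  destruct k; [revert x; change (forall x : R, x = x + 0 * 0); intros; ring|]. destruct x as [a b]. simpl. unfold Cadd, Cmul. simpl. f_equal; ring.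
Qed.

Lemma sre_le k x : Rabs (sre k x) <= sabs k x.
Proof.
  destruct k; simpl; [lra|]. destruct x as [a b]. unfold Cmod. simpl.
  rewrite <- sqrt_Rsqr_abs. apply sqrt_le_1_alt. unfold Rsqr.
  assert (0 <= b * b) by apply Rle_0_sqr. lra.
Qed.

Lemma sim_le k x : Rabs (sim k x) <= sabs k x.
Proof.
  destruct k; simpl; [rewrite Rabs_R0; apply Rabs_pos|]. destruct x as [a b]. unfold Cmod. simpl.
  rewrite <- sqrt_Rsqr_abs. apply sqrt_le_1_alt. unfold Rsqr.
  assert (0 <= a * a) by apply Rle_0_sqr. lra.
Qed.

Lemma siota_le k : sabs k (siota k) <= 1.
Proof.
  destruct k; simpl; [rewrite Rabs_R0; lra|]. unfold Cmod. simpl.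
  rewrite <- sqrt_1 at 3. apply sqrt_le_1_alt. lra.
Qed.

(** Slots below d may be non-real. Splitting one of them as Re + i Im doubles the bound and
    preserves the envelope W, since neither part exceeds the modulus. *)
Lemma complexify_bound k m n T W Bd : multilinear k m n T ->
  (forall X : nat -> nat -> R, (forall l i, Rabs (X l i) <= W l i) ->
     sabs k (T (fun l i => rk k (X l i))) <= Bd) ->
  forall d, (d <= m)%nat -> forall Z X0, (forall l i, (d <= l)%nat -> Z l i = rk k (X0 l i)) ->
  (forall l i, sabs k (Z l i) <= W l i) -> sabs k (T Z) <= 2 ^ d * Bd.
Proof.
  intros HT H. induction d; intros Hd Z X0 HZ HW.
  - simpl. rewrite Rmult_1_l.
    replace Z with (fun l i => rk k (X0 l i)).
    + apply H. intros l i. rewrite <- (sabs_rk k), <- HZ by lia. apply HW.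
    + apply functional_extensionality. intros l. apply functional_extensionality. intros i.
      symmetry. apply HZ. lia.
  - assert (E : Z = updv Z d (fun i => sadd k (rk k (sre k (Z d i))) (smul k (siota k) (rk k (sim k (Z d i)))))).
    { rewrite <- (updv_id Z d) at 1. f_equal. apply functional_extensionality. intros; apply scal_split. }
    assert (R : forall g : scal k -> R, (forall x, Rabs (g x) <= sabs k x) ->
      sabs k (T (updv Z d (fun i => rk k (g (Z d i))))) <= 2 ^ d * Bd).
    { intros g Hg. apply (IHd ltac:(lia) _ (updv X0 d (fun i => g (Z d i)))).
      - intros l i Hl. unfold updv. destruct (Nat.eqb_spec l d) as [->|]; auto. apply HZ. lia.
      - intros l i. unfold updv. destruct (Nat.eqb_spec l d) as [->|]; auto.
        rewrite sabs_rk. eapply Rle_trans; [apply Hg|apply HW]. }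
    rewrite E, (proj2 HT d Z) by lia. eapply Rle_trans; [apply sabs_add|]. rewrite sabs_mul.
    assert (R1 := R _ (sre_le k)). assert (R2 := R _ (sim_le k)).
    assert (I := siota_le k). assert (I0 := sabs_ge0 k (siota k)).
    assert (P := sabs_ge0 k (T (updv Z d (fun i => rk k (sim k (Z d i)))))).
    simpl pow. nra.
Qed.

(** For p >= 2 the l_p ball lies in n^(1/2 - 1/p) times the Euclidean ball, by Hölder's inequality
    against 1; the bound is for squares, hence the repeated factor. *)
Lemma lpnorm_l2 k n p x : ge2 p -> (0 < n)%nat -> lpnorm k n p x <= 1 ->
  rsum n (fun i => sabs k (x i) * sabs k (x i))
  <= Rpower (INR n) (1 / 2 - invp p) * Rpower (INR n) (1 / 2 - invp p).
Proof.
  intros Hp Hn H. assert (HN : 0 < INR n) by (apply lt_0_INR; auto).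
  rewrite <- Rpower_plus. destruct p as [q|]; cbn [lpnorm invp] in *.
  - simpl in Hp. set (A := rsum n (fun i => rpow (sabs k (x i)) q)) in *.
    assert (HA : 0 <= A) by (apply rsum_nonneg; intros; apply rpow_ge0).
    assert (HA1 : A <= 1).
    { rewrite <- (rpow_inv_cancel' A q) by lra. apply rpow_le_1; auto. lra. }
    assert (Hth : 0 <= 2 / q <= 1).
    { split; [apply Rle_mult_inv_pos; lra|]. apply (Rmult_le_reg_r q); [lra|].
      unfold Rdiv. rewrite Rmult_assoc, Rinv_l; lra. }
    pose proof (rsum_holder n (fun i => rpow (sabs k (x i)) q) (fun _ => 1) (2 / q) Hth
      ltac:(intros; apply rpow_ge0) ltac:(intros; lra)) as H1.
    rewrite rsum_const, Rmult_1_r in H1. fold A in H1.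
    rewrite (rsum_ext n _ (fun i => rpow (rpow (sabs k (x i)) q) (2 / q) * rpow 1 (1 - 2 / q))).
    + eapply Rle_trans; [exact H1|]. rewrite (rpow_pos (INR n)) by auto.
      replace (1 / 2 - 1 / q + (1 / 2 - 1 / q)) with (1 - 2 / q) by (field; lra).
      rewrite <- (Rmult_1_l (Rpower _ _)) at 2. apply Rmult_le_compat_r; [left; apply exp_pos|].
      apply rpow_le_1; lra.
    + intros i Hi. rewrite rpow_one, Rmult_1_r, rpow_rpow.
      replace (q * (2 / q)) with (1 + 1) by (field; lra).
      rewrite rpow_plus, !rpow_1 by apply sabs_ge0. reflexivity.
  - replace (1 / 2 - 0 + (1 / 2 - 0)) with 1 by lra. rewrite Rpower_1 by auto.
    rewrite <- (Rmult_1_r (INR n)), <- rsum_const. apply rsum_le. intros i Hi.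
    assert (sabs k (x i) <= 1) by (eapply Rle_trans; [apply supnorm_ge; eauto|auto]).
    assert (0 <= sabs k (x i)) by apply sabs_ge0. nra.
Qed.

(* Kahane-Salem-Zygmund, up to the factor n^de. *)
Lemma random_form k m p de : (0 < m)%nat -> (forall j, (j < m)%nat -> ge2 (p j)) -> 0 < de ->
  exists K, 0 < K /\ forall n, (0 < n)%nat -> exists c : (nat -> nat) -> R, (forall i, is_sign (c i)) /\
  forall X, (forall j, (j < m)%nat -> lpnorm k n (p j) (X j) <= 1) ->
  sabs k (tform k n 0 m c X zidx) <= K * Rpower (INR n) (INR m / 2 - invp_sum m p + 1 / 2 + de).
Proof.
  intros Hm Hp Hd. destruct (random_form_real m de Hm Hd) as [K [HK H]].
  exists (2 ^ m * K). split; [apply Rmult_lt_0_compat; auto; apply pow_lt; lra|].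
  intros n Hn. destruct (H n Hn) as [c [Hc1 Hc2]]. exists c. split; auto. intros X HX.
  assert (HN : 0 < INR n) by (apply lt_0_INR; auto).
  set (sc := fun l => Rpower (INR n) (1 / 2 - invp (p l))).
  assert (Hsc : forall l, 0 < sc l) by (intros; apply exp_pos).
  (* Slots from m on are set to 0, because [complexify_bound] asks for real vectors there. *)
  set (Z := fun l i => if Nat.ltb l m then X l i else rk k 0).
  assert (HT := tform_multilinear k m n n c zidx (le_n n)).
  replace (tform k n 0 m c X zidx) with (tform k n 0 m c Z zidx).
  2:{ apply tform_ext. intros j i Hj Hi. unfold Z. destruct (Nat.ltb_spec j m); [auto|lia]. }
  assert (Etot : rprodr 0 m sc = Rpower (INR n) (INR m / 2 - invp_sum m p)).
  { unfold sc. rewrite rprodr_Rpower, rsumr_rsum. f_equal.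
    rewrite (rsum_ext m _ (fun j => 1 / 2 + -1 * invp (p j))) by (intros; ring).
    rewrite rsum_plus, rsum_const, rsum_scal. unfold invp_sum. field. }
  rewrite Rmult_assoc.
  apply (complexify_bound k m n _ (fun l i => sabs k (Z l i)) _ HT) with (X0 := fun _ _ => 0) (d := m); auto.
  2:{ intros l i Hl. unfold Z. destruct (Nat.ltb_spec l m); [lia|auto]. }
  2:{ intros; lra. }
  intros Y HY. rewrite tform_rk, sabs_rk.
  assert (HTR := tform_multilinear KR m n n c zidx (le_n n)).
  (* Rescaling into Euclidean balls; the product of the scales is n^(m/2 - |1/p|). *)
  set (Y' := fun l i => Y l i / sc l).
  replace (tform KR n 0 m c Y zidx) with (rprodr 0 m sc * tform KR n 0 m c Y' zidx).
  2:{ rewrite <- (mlin_rescale m n _ HTR sc Y' m 0) by lia. apply (tform_ext KR). intros j i Hj Hi.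
      destruct (Nat.leb_spec 0 j), (Nat.ltb_spec j (0 + m)); try lia. simpl. unfold Y'.
      field. specialize (Hsc j). lra. }
  rewrite Rabs_mult, Etot, Rabs_pos_eq by (left; apply exp_pos).
  replace (INR m / 2 - invp_sum m p + 1 / 2 + de) with (INR m / 2 - invp_sum m p + (1 / 2 + de)) by ring.
  rewrite (Rpower_plus (INR m / 2 - invp_sum m p)), <- Rmult_assoc, (Rmult_comm K), Rmult_assoc.
  apply Rmult_le_compat_l; [left; apply exp_pos|]. apply Hc2.
  intros l Hl. assert (L := lpnorm_l2 k n (p l) (X l) (Hp l Hl) Hn (HX l Hl)).
  fold (sc l) in L. specialize (Hsc l).
  rewrite (rsum_ext n _ (fun i => / (sc l * sc l) * (Y l i * Y l i))) by (intros; unfold Y'; field; lra).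
  rewrite rsum_scal. apply (Rmult_le_reg_l (sc l * sc l)); [nra|].
  rewrite <- Rmult_assoc, Rinv_r by nra. rewrite Rmult_1_l, Rmult_1_r.
  eapply Rle_trans; [|exact L]. apply rsum_le. intros i Hi. specialize (HY l i).
  unfold Z in HY. destruct (Nat.ltb_spec l m); [|lia].
  apply sq_le_of_Rabs. rewrite (Rabs_pos_eq (sabs _ _)) by apply sabs_ge0. exact HY.
Qed.

(** * Sharpness *)

Lemma opnorm_exists k m n p T Bd : (forall j, (j < m)%nat -> ge2 (p j)) ->
  (forall X, (forall j, (j < m)%nat -> lpnorm k n (p j) (X j) <= 1) -> sabs k (T X) <= Bd) ->
  exists N, is_opnorm k m n p T N /\ 0 <= N <= Bd.
Proof.
  intros Hp H.
  assert (H0 : exists X, forall j, (j < m)%nat -> lpnorm k n (p j) (X j) <= 1).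
  { exists (fun _ _ => szero k). intros; apply lpnorm_szero; auto. }
  destruct (completeness (fun y => exists X : nat -> nat -> scal k,
             (forall j, (j < m)%nat -> lpnorm k n (p j) (X j) <= 1) /\ y = sabs k (T X))) as [N HN].
  - exists Bd. intros y [X [HX ->]]. auto.
  - destruct H0 as [X HX]. exists (sabs k (T X)). eauto.
  - exists N. split; [exact HN|]. split.
    + eapply (opnorm_ge0 k m n p T N); eauto.
    + apply (proj2 HN). intros y [X [HX ->]]. auto.
Qed.

Lemma Rpower_unbounded a A : 0 < a -> exists n, (0 < n)%nat /\ A < Rpower (INR n) a.
Proof.
  intros Ha. set (B := Rmax A 1).
  assert (HB : 1 <= B) by apply Rmax_r. assert (HA : A <= B) by apply Rmax_l.
  destruct (INR_unbounded (Rpower B (1 / a))) as [n Hn].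
  assert (P : 0 < Rpower B (1 / a)) by apply exp_pos.
  exists n. split; [apply INR_lt; simpl; lra|].
  apply Rle_lt_trans with B; auto.
  replace B with (Rpower (Rpower B (1 / a)) a) at 1.
  - apply Rlt_Rpower_l; auto.
  - rewrite Rpower_mult. replace (1 / a * a) with 1 by (field; lra). apply Rpower_1; lra.
Qed.

Lemma mixn_one n r d : (0 < n)%nat -> forall l F idx, (forall j, (l <= j < l + d)%nat -> 0 < r j) ->
  (forall i, in_box n l d idx i -> F i = 1) ->
  mixn n r l d F idx = Rpower (INR n) (rsumr l d (fun j => 1 / r j)).
Proof.
  intros Hn. assert (HN : 0 < INR n) by (apply lt_0_INR; auto).
  induction d; intros l F idx Hr HF; cbn [mixn rsumr].
  - rewrite Rpower_O by auto. apply HF, in_box_refl.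
  - assert (Hl : 0 < r l) by (apply Hr; lia).
    set (A := Rpower (INR n) (rsumr (S l) d (fun j => 1 / r j))).
    rewrite (rsum_ext n _ (fun _ => rpow A (r l))).
    + rewrite rsum_const, rpow_mult by (try apply rpow_ge0; lra).
      rewrite rpow_inv_cancel by (try (left; apply exp_pos); lra).
      rewrite rpow_pos by auto. unfold A. rewrite <- Rpower_plus. reflexivity.
    + intros i Hi. f_equal. apply IHd; [intros; apply Hr; lia|].
      intros i' Hb. apply HF. eapply in_box_step; eauto.
Qed.

Lemma mixn_ge_zidx n r d : (0 < n)%nat -> forall l F idx, (forall j, (l <= j < l + d)%nat -> 0 < r j) ->
  (forall i, 0 <= F i) -> idx = zidx -> F zidx <= mixn n r l d F idx.
Proof.
  intros Hn. induction d; intros l F idx Hr HF ->; cbn [mixn]; [lra|].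
  assert (Hl : 0 < r l) by (apply Hr; lia).
  eapply Rle_trans; [apply (IHd (S l) F (updv zidx l O))|].
  - intros; apply Hr; lia.
  - auto.
  - apply (updv_id zidx l).
  - rewrite <- (rpow_inv_cancel (mixn n r (S l) d F (updv zidx l O)) (r l)) by (try apply mixn_ge0; auto; lra).
    apply rpow_le; [apply Rle_mult_inv_pos; lra|].
    apply (rsum_term_le n (fun i => rpow (mixn n r (S l) d F (updv zidx l i)) (r l)) O); auto.
    intros; apply rpow_ge0.
Qed.

Lemma sharp_all k m p r : (2 <= m)%nat -> (forall j, (j < m)%nat -> ge2 (p j)) ->
  invp_sum m p <= 1 / 2 -> (forall j, (j < m)%nat -> 0 < r j) ->
  (forall j, (j < m)%nat -> r j < rhoHL m p) ->
  forall t, t < s_exp m p r -> forall D,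
  exists (n : nat) (T : (nat -> nat -> scal k) -> scal k) (N : R),
    (0 < n)%nat /\ multilinear k m n T /\ is_opnorm k m n p T N /\
    D * Rpower (INR n) t * N < mixed_sum k m n r T.
Proof.
  intros Hm Hp Hs Hr Hall t Ht D.
  assert (HM : 1 <= INR m) by (apply (le_INR 1); lia).
  set (Sr := rsum m (fun j => 1 / r j)).
  assert (Es : s_exp m p r = Sr - (INR m + 1 - 2 * invp_sum m p) / 2).
  { unfold s_exp, cardM, Sr.
    rewrite (rsum_ext m (fun j => if Rlt_dec (r j) (rhoHL m p) then 1 / r j else 0) (fun j => 1 / r j)).
    2:{ intros j Hj. destruct Rlt_dec as [|Hf]; auto. exfalso. apply Hf; auto. }
    rewrite (rsum_ext m (fun j => if Rlt_dec (r j) (rhoHL m p) then 1 else 0) (fun j => 1)).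
    2:{ intros j Hj. destruct Rlt_dec as [|Hf]; auto. exfalso. apply Hf; auto. }
    rewrite rsum_const. field. lra. }
  (* Half of the gap s - t absorbs the loss in the random form; the other half makes n^de exceed |D|
     K. *)
  set (de := (s_exp m p r - t) / 2). assert (Hde : 0 < de) by (unfold de; lra).
  destruct (random_form k m p de ltac:(lia) Hp Hde) as [K [HK H]].
  destruct (Rpower_unbounded de (Rabs D * K) Hde) as [n [Hn Hbig]].
  assert (HN : 0 < INR n) by (apply lt_0_INR; auto).
  destruct (H n Hn) as [c [Hc1 Hc2]].
  destruct (opnorm_exists k m n p (fun X => tform k n 0 m c X zidx) _ Hp Hc2) as [N [HN1 HN2]].
  exists n, (fun X => tform k n 0 m c X zidx), N.
  split; [auto|]. split; [apply tform_multilinear; auto|]. split; [exact HN1|].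
  unfold mixed_sum. rewrite (mixn_one n r m Hn).
  - rewrite rsumr_rsum. fold Sr.
    set (ex := INR m / 2 - invp_sum m p + 1 / 2 + de) in *.
    assert (P1 : 0 < Rpower (INR n) t) by apply exp_pos.
    assert (P2 : 0 < Rpower (INR n) ex) by apply exp_pos.
    apply Rle_lt_trans with (Rabs D * K * Rpower (INR n) (t + ex)).
    + rewrite Rpower_plus.
      apply Rle_trans with (Rabs D * Rpower (INR n) t * N).
      * apply Rmult_le_compat_r; [lra|]. apply Rmult_le_compat_r; [lra|]. apply Rle_abs.
      * replace (Rabs D * K * (Rpower (INR n) t * Rpower (INR n) ex))
          with (Rabs D * Rpower (INR n) t * (K * Rpower (INR n) ex)) by ring.
        apply Rmult_le_compat_l; [|lra]. apply Rmult_le_pos; [apply Rabs_pos|lra].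
    + replace Sr with (de + (t + ex)) by (unfold ex, de; lra).
      rewrite (Rpower_plus de). apply Rmult_lt_compat_r; [apply exp_pos|auto].
  - intros; apply Hr; lia.
  - intros idx Hb. destruct (tform_ebasis k n c idx m 0 zidx) as [i Ei].
    + intros j Hj. apply Hb; lia.
    + rewrite Ei, sabs_rk. destruct (Hc1 i) as [-> | ->]; [apply Rabs_R1|rewrite Rabs_left; lra].
Qed.

(** Here s = 0 and t < 0. The norm is at most 1 and one coefficient has modulus 1, whatever n, so
    letting n grow makes D n^t as small as desired. *)
Lemma sharp_none k m p r : (2 <= m)%nat -> (forall j, (j < m)%nat -> ge2 (p j)) ->
  (forall j, (j < m)%nat -> 0 < r j) ->
  (forall j, (j < m)%nat -> ~ r j < rhoHL m p) ->
  forall t, t < s_exp m p r -> forall D,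
  exists (n : nat) (T : (nat -> nat -> scal k) -> scal k) (N : R),
    (0 < n)%nat /\ multilinear k m n T /\ is_opnorm k m n p T N /\
    D * Rpower (INR n) t * N < mixed_sum k m n r T.
Proof.
  intros Hm Hp Hr Hnone t Ht D.
  assert (Es : s_exp m p r = 0).
  { unfold s_exp, cardM.
    rewrite (rsum_ext m (fun j => if Rlt_dec (r j) (rhoHL m p) then 1 / r j else 0) (fun j => 0)).
    2:{ intros j Hj. destruct Rlt_dec as [Hf|]; auto. exfalso. apply (Hnone j); auto. }
    rewrite (rsum_ext m (fun j => if Rlt_dec (r j) (rhoHL m p) then 1 else 0) (fun j => 0)).
    2:{ intros j Hj. destruct Rlt_dec as [Hf|]; auto. exfalso. apply (Hnone j); auto. }
    rewrite rsum_zero. ring. }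
  destruct (Rpower_unbounded (- t) (Rabs D) ltac:(lra)) as [n [Hn Hbig]].
  set (T := fun X => tform k 1 0 m (fun _ => 1) X zidx).
  assert (HT : forall X, (forall j, (j < m)%nat -> lpnorm k n (p j) (X j) <= 1) -> sabs k (T X) <= 1).
  { intros X HX. unfold T. eapply Rle_trans; [apply tform_bound|].
    - intros _. rewrite Rabs_R1. lra.
    - intros j i Hj Hi. replace i with O by lia. specialize (HX j ltac:(lia)). specialize (Hp j ltac:(lia)).
      destruct (p j) as [q|]; cbn [lpnorm] in HX.
      + simpl in Hp. set (A := rsum n (fun i => rpow (sabs k (X j i)) q)) in *.
        assert (HA : 0 <= A) by (apply rsum_nonneg; intros; apply rpow_ge0).
        eapply Rle_trans; [|exact HX].
        rewrite <- (rpow_inv_cancel (sabs k (X j O)) q) by (try apply sabs_ge0; lra).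
        apply rpow_le; [apply Rle_mult_inv_pos; lra|].
        apply (rsum_term_le n (fun i => rpow (sabs k (X j i)) q) O); auto. intros; apply rpow_ge0.
      + eapply Rle_trans; [apply supnorm_ge; eauto|auto].
    - simpl INR. rewrite pow1. lra. }
  destruct (opnorm_exists k m n p T 1 Hp HT) as [N [HN1 HN2]].
  exists n, T, N. split; [auto|]. split; [apply tform_multilinear; lia|]. split; [exact HN1|].
  apply Rlt_le_trans with 1.
  - assert (P : 0 < Rpower (INR n) t) by apply exp_pos.
    assert (E : Rpower (INR n) (- t) * Rpower (INR n) t = 1).
    { rewrite <- Rpower_plus, Rplus_opp_l. apply Rpower_O. apply lt_0_INR; auto. }
    assert (D <= Rabs D) by apply Rle_abs. assert (0 <= Rabs D) by apply Rabs_pos.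
    apply Rle_lt_trans with (Rabs D * Rpower (INR n) t).
    + apply Rle_trans with (Rabs D * Rpower (INR n) t * N).
      * apply Rmult_le_compat_r; [lra|]. apply Rmult_le_compat_r; lra.
      * rewrite <- (Rmult_1_r (Rabs D * Rpower (INR n) t)) at 2. apply Rmult_le_compat_l; [|lra].
        apply Rmult_le_pos; lra.
    + rewrite <- E. apply Rmult_lt_compat_r; auto.
  - unfold mixed_sum.
    eapply Rle_trans; [|apply (mixn_ge_zidx n r m Hn)].
    + destruct (tform_ebasis k 1 (fun _ => 1) zidx m 0 zidx) as [i Ei].
      * intros; unfold zidx; lia.
      * unfold T. rewrite Ei, sabs_rk, Rabs_R1. lra.
    + intros; apply Hr; lia.
    + intros; apply sabs_ge0.
    + reflexivity.
Qed.

Theorem mainTheorem2 :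
  forall (k : field_kind) (m : nat) (p : nat -> ExtR),
    (2 <= m)%nat ->
    (forall j, (j < m)%nat -> ge2 (p j)) ->
    invp_sum m p <= 1 / 2 ->
    (exists D : R, 1 <= D /\
       forall (r : nat -> R), (forall j, (j < m)%nat -> 0 < r j) ->
       forall (n : nat), (0 < n)%nat ->
       forall (T : (nat -> nat -> scal k) -> scal k) (N : R),
         multilinear k m n T -> is_opnorm k m n p T N ->
         mixed_sum k m n r T <= D * Rpower (INR n) (s_exp m p r) * N)
    /\
    (forall (r : nat -> R), (forall j, (j < m)%nat -> 0 < r j) ->
       ((forall j, (j < m)%nat -> r j < rhoHL m p) \/
        (forall j, (j < m)%nat -> ~ r j < rhoHL m p)) ->
       forall (t : R), t < s_exp m p r ->
       forall (D : R),
         exists (n : nat) (T : (nat -> nat -> scal k) -> scal k) (N : R),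
           (0 < n)%nat /\ multilinear k m n T /\ is_opnorm k m n p T N /\
           D * Rpower (INR n) t * N < mixed_sum k m n r T).
Proof.
  intros k m p Hm Hp Hs. split.
  - exists (4 * (9 / 2) ^ m). split.
    + assert (1 <= (9 / 2) ^ m) by (apply pow_R1_Rle; lra). lra.
    + apply mixed_upper_bound; auto.
  - intros r Hr [Hall|Hnone] t Ht D.
    + apply sharp_all; auto.
    + apply sharp_none; auto.
Qed.
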